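(* Let $\mathbb X$ be a flow space which is dense at the point $x_\bullet$. If $\mathbb X$ is aperiodic, then $\mathbb X$ admits an expansion $(X_i,f_i,p_i)$ about $x_\bullet$ in which every bonding map $f_i$ is proper. Otherwise, $\mathbb X$ admits an expansion about $x_\bullet$ for which $f_{1,n}=f_1\circ\cdots\circ f_{n-1}$ is degenerate proper for every $n\ge2$. In particular, every minimal flow space admits an expansion about each of its points.
   Context: A flow space is a compact metrizable space $\mathbb X$ of topological dimension one with a continuous $\mathbb R$-action $(t,x)\mapsto t.x$ without fixed points. It is minimal if every orbit is dense and aperiodic if no orbit is periodic (homeomorphic to a circle). $\mathbb X$ is dense at $x$ if every neighbourhood of $x$ meets the forward orbit $\{t.y:t>0\}$ of every $y\in\mathbb X$. Oriented wedge of circles: one-point union of finitely many circles, each oriented. Positive map: continuous surjection between oriented wedges sending wedge point to wedge point, orientation preserving on each circle, locally injective away from the wedge point. Projection $p\colon\mathbb X\to W$: continuous surjection, locally injective and orientation preserving along orbits. Expansion about $x_\bullet$: oriented wedges $X_i$ (wedge points $x_i$), positive maps $f_i\colon X_{i+1}\to X_i$, projections $p_i$ with $p_i(x_\bullet)=x_i$, $p_n=f_{n,m}\circ p_m$ ($m>n$, $f_{n,m}=f_n\circ\cdots\circ f_{m-1}$), and $x\mapsto(p_i(x))_i$ a homeomorphism onto $\varprojlim(X_i,f_i)$. Symbolic representation $f_s$ of a positive map $f$ (circles labelled by letters): $f_s(b)$ is the word of circles traversed, in order, by the image of circle $b$ traversed once positively from the wedge point. $f$ is proper if there are letters $c,d$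 with every $f_s(b)$ of the form $c\,v_b\,d$ ($v_b$ a possibly empty word); degenerate proper if there is a letter $a$ with every $f_s(b)$ beginning and ending with $a$ and $f_s(b)=a$ for at least one $b$. *)

(* Defs.v *)
From HB Require Import structures.
From mathcomp Require Import all_boot all_order all_algebra.
From mathcomp Require Import all_classical all_reals all_analysis.

Set Implicit Arguments.
Unset Strict Implicit.
Unset Printing Implicit Defensive.
Import Order.TTheory GRing.Theory Num.Theory.
Import numFieldNormedType.Exports.
Local Open Scope classical_set_scope.
Local Open Scope ring_scope.

Section FlowDefs.
Variable R : realType.

Definition metrizable (X : topologicalType) : Prop :=
  exists d : X -> X -> R,
    [/\ (forall x y, 0 <= d x y),
        (forall x y, d x y = 0 <-> x = y),
        (forall x y, d x y = d y x),
        (forall x y z, d x z <= d x y + d y z) &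
        (forall A : set X, open A <->
           (forall x, A x -> exists e : R, 0 < e /\ [set y | d x y < e] `<=` A))].

Definition covdim_le (X : topologicalType) (n : nat) : Prop :=
  forall (m : nat) (U : 'I_m -> set X),
    (forall i, open (U i)) -> (forall x, exists i, U i x) ->
    exists (l : nat) (V : 'I_l -> set X),
      [/\ (forall j, open (V j)),
          (forall x, exists j, V j x),
          (forall j, exists i, V j `<=` U i) &
          (forall x (S : seq 'I_l), uniq S -> (forall j, j \in S -> V j x) ->
             (size S <= n.+1)%N)].

Definition topdim_one (X : topologicalType) : Prop :=
  covdim_le X 1 /\ ~ covdim_le X 0.

Definition flow_space (X : topologicalType) (act : R -> X -> X) : Prop :=
  [/\ compact [set: X], metrizable X, topdim_one X,
      continuous (fun q : R * X => act q.1 q.2) &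
    [/\ (forall x, act 0 x = x),
      (forall s t x, act (s + t) x = act s (act t x)) &
      (forall x, exists t, act t x <> x)]].

Definition minimal_flow (X : topologicalType) (act : R -> X -> X) : Prop :=
  forall x : X, closure (range (fun t => act t x)) = [set: X].

Definition aperiodic (X : topologicalType) (act : R -> X -> X) : Prop :=
  forall (x : X) (t : R), t != 0 -> act t x <> x.

Definition dense_at (X : topologicalType) (act : R -> X -> X) (x : X) : Prop :=
  forall (y : X) (U : set X), nbhs x U -> exists t : R, 0 < t /\ U (act t y).

(* Oriented wedges of circles: the standard model of a wedge of k circles  *)
(* in the plane R*R.  Circle number b (b < k) has radius b+1, centre       *)
(* (b+1, 0), passes through the wedge point (0,0), and is oriented by the   *)
(* 1-periodic parametrisation  s |-> E b s  (E b 0 = wedge point).          *)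

Definition E (b : nat) (s : R) : R * R :=
  ((b.+1)%:R * (1 - cos (2 * pi * s)), (b.+1)%:R * sin (2 * pi * s)).

Definition wpt : R * R := (0, 0).

Definition Wedge (k : nat) : set (R * R) :=
  [set z | exists b s, (b < k)%N /\ z = E b s].

(* g : R -> R*R is locally injective and orientation preserving (as a map
   into the oriented wedge with k circles) at every point of the set I:
   around each t0 in I, on the left of t0 and on the right of t0, g runs
   along a single circle in the positive direction (with a continuous
   strictly increasing parameter). *)
Definition incr_on (s : R -> R) (A : set R) : Prop :=
  forall x y, A x -> A y -> x < y -> s x < s y.

Definition opli (k : nat) (g : R -> R * R) (I : set R) : Prop :=
  forall t0, I t0 -> exists d : R, 0 < d /\
    [set t | t0 - d <= t <= t0 + d] `<=` I /\
    exists (c c' : nat) (s s' : R -> R),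
      [/\ (c < k)%N, (c' < k)%N,
          [/\ {within [set t | t0 - d <= t <= t0], continuous s},
              incr_on s [set t | t0 - d <= t <= t0] &
              forall t, t0 - d <= t <= t0 -> g t = E c (s t)] &
          [/\ {within [set t | t0 <= t <= t0 + d], continuous s'},
              incr_on s' [set t | t0 <= t <= t0 + d] &
              forall t, t0 <= t <= t0 + d -> g t = E c' (s' t)]].

Definition positive_map (m k : nat) (f : R * R -> R * R) : Prop :=
  [/\ {within Wedge m, continuous f},
      f @` Wedge m = Wedge k,
      f wpt = wpt &
      forall b, (b < m)%N -> opli k (fun s => f (E b s)) [set s | 0 < s < 1]].

Definition projection (X : topologicalType) (act : R -> X -> X)
    (k : nat) (p : X -> R * R) : Prop :=
  [/\ continuous p,
      range p = Wedge k &
      forall x, opli k (fun t => p (act t x)) [set: R]].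

Fixpoint fcomp (f : nat -> R * R -> R * R) (n d : nat) : R * R -> R * R :=
  match d with
  | 0 => id
  | d'.+1 => fcomp f n d' \o f (n + d')%N
  end.

Definition invlim (k : nat -> nat) (f : nat -> R * R -> R * R) :
    set {ptws nat -> (R * R)%type} :=
  [set w | forall i, Wedge (k i) (w i) /\ f i (w i.+1) = w i].

Definition expansion (X : topologicalType) (act : R -> X -> X) (xb : X)
    (k : nat -> nat) (f : nat -> R * R -> R * R) (p : nat -> X -> R * R) : Prop :=
  let phi : X -> {ptws nat -> (R * R)%type} := fun x i => p i x in
  [/\ (forall i, positive_map (k i.+1) (k i) (f i)),
      (forall i, projection act (k i) (p i)),
      (forall i, p i xb = wpt),
      (forall n m, (n < m)%N -> forall x, p n x = fcomp f n (m - n) (p m x)) &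
      [/\ continuous phi, injective phi, range phi = invlim k f &
          forall A : set X, open A ->
            exists B : set {ptws nat -> (R * R)%type}, open B /\ phi @` A = B `&` invlim k f]].

Definition symb (f : R * R -> R * R) (b : nat) (w : seq nat) : Prop :=
  exists tau : nat -> R,
    [/\ tau 0%N = 0, tau (size w) = 1,
        (forall j, (j < size w)%N -> tau j < tau j.+1),
        (forall j, (j <= size w)%N -> f (E b (tau j)) = wpt) &
        (forall j, (j < size w)%N -> forall s, tau j < s < tau j.+1 ->
           f (E b s) <> wpt /\ exists u, f (E b s) = E (nth 0%N w j) u)].

Definition proper_map (m : nat) (f : R * R -> R * R) : Prop :=
  exists c d : nat, forall b, (b < m)%N -> exists v, symb f b (c :: rcons v d).

Definition degenerate_proper (m : nat) (f : R * R -> R * R) : Prop :=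
  exists a : nat,
    (forall b, (b < m)%N -> exists w, symb f b w /\ w != [::] /\
        head 0%N w = a /\ last 0%N w = a) /\
    (exists b, (b < m)%N /\ symb f b [:: a]).

End FlowDefs.

(* Main.v *)
(** A local time coordinate near [x_b] yields a compact local section of the flow;
since the space has covering dimension at most one, the section is
zero-dimensional: for a cover of order two, the parity of the number of crossings
of a flow segment through a given part of the cover is locally constant on the
section.  A small clopen piece [C] of the section is a cross-section whose return
map [T] is a homeomorphism of a zero-dimensional compact space, so that the flow
is a suspension of [T].  Kakutani-Rokhlin towers over a decreasing sequence of
clopen neighbourhoods of [x_b] in [C], with finer and finer labels, give wedges
of circles (one circle per tower) and projections that traverse each floor of a
tower at a constant speed.  Tower [b] of level [n + 1] crosses the towers of
level [n] in an order that depends on [b] only: this is the bonding map.  Small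
bases make the first and the last tower crossed independent of [b]. *)

(* The obstacle is that a projection sends the whole base of its towers to the wedge point, so a
   level sees nothing of the position inside its base, yet it must determine the previous level
   there too. Hence the base of level [n + 1] lies in that of level [n], and on it the label of
   stage [n], the [n]-tower entered and the [n]-tower just left are the same as at [x_b]. Such
   clopen conditions make the bonding map well defined at the wedge point, keep the limit map
   injective and fix the first and last letters. If [x_b] is not periodic, the base is also made
   disjoint from its image after one [n]-tower; every word then has at least two letters, so its
   first and last letters occupy different places. If some orbit is periodic, density forces [x_b]
   onto it and this room is lost. The base of level 0 is then made to meet the orbit of [x_b] in
   [x_b] alone, so that the tower over [x_b], at every level, crosses a single tower of level 0. *)
Require Import Defs.
From HB Require Import structures.
From mathcomp Require Import all_boot all_order all_algebra.
From mathcomp Require Import all_classical all_reals all_analysis.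
From mathcomp Require Import zify ring lra.
Set Implicit Arguments.
Unset Strict Implicit.
Unset Printing Implicit Defensive.
Import Order.TTheory GRing.Theory Num.Theory.
Import numFieldNormedType.Exports.
Local Open Scope classical_set_scope.
Local Open Scope ring_scope.

(** * The model circles and their parametrisations *)

Section Circles.
Variable R : realType.
Implicit Types (s t : R) (b c : nat).

(** Half-angle formula: [1 - cos x] is twice the square of the sine at [|x| / 2], which lies in
    [(0, pi)] when [x] is nonzero. *)
Lemma cos_eq1_small (x : R) : `|x| < 2 * pi -> cos x = 1 -> x = 0.
Proof.
move=> xpi; rewrite -cos_norm => c1; apply/normr0_eq0/eqP/negPn/negP => x0.
have y0 : 0 < `|x| / 2 < pi.
  have : 0 < `|x| by rewrite lt_neqAle eq_sym x0 normr_ge0.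
  by lra.
have /(exprn_gt0 2) s2 := sin_gt0_pi y0.
have e : `|x| = (`|x| / 2) *+ 2 by rewrite -mulr_natr; field.
move: c1; rewrite e cos_mulr2n => c1.
have := cos2Dsin2 (`|x| / 2).
lra.
Qed.

Lemma E0 b : E b 0 = wpt R.
Proof. by rewrite /E !mulr0 cos0 sin0 subrr !mulr0. Qed.

Lemma E1 b : E b 1 = wpt R.
Proof.
by rewrite /E mulr1 (mulr_natl pi 2) cos2pi sin2pi subrr !mulr0.
Qed.

Lemma E_wpt b s : 0 <= s < 1 -> E b s = wpt R -> s = 0.
Proof.
move=> s01 [] /eqP; rewrite mulf_eq0 pnatr_eq0 /= subr_eq0 => /eqP c1 _.
have pi0 := @pi_gt0 R.
have : 2 * pi * s = 0.
  by apply: cos_eq1_small => //; rewrite ger0_norm; nra.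
by move=> /eqP; rewrite !mulf_eq0 pnatr_eq0 (gt_eqF pi0) /= => /eqP.
Qed.

(** The circles are tangent at the origin, and away from it the equation of a circle recovers its
    radius. Then sine and cosine agree, so the two angles differ by less than [2 * pi] and their
    difference has cosine 1. *)
Lemma E_inj b c s t : 0 < s < 1 -> 0 < t < 1 -> E b s = E c t -> b = c /\ s = t.
Proof.
move=> s01 t01 Est.
have pi0 := @pi_gt0 R.
have sn1 : cos (2 * pi * s) != 1.
  apply/eqP => c1; have : s = 0.
    apply: (@E_wpt b); first by lra.
    have := cos2Dsin2 (2 * pi * s); rewrite c1 expr1n.
    move=> /(canRL (addKr _)); rewrite addNr => /eqP; rewrite sqrf_eq0 => /eqP s0.
    by rewrite /E c1 s0 subrr !mulr0.
  by lra.
case: Est; set x := 2 * pi * s in sn1 *; set y := 2 * pi * t => e1 e2.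
have cx := cos2Dsin2 x; have cy := cos2Dsin2 y.
have cx1 : cos x < 1 by rewrite lt_neqAle sn1 cos_le1.
have e3 : (b.+1%:R : R) = c.+1%:R.
  have b0 : (0 : R) < b.+1%:R by rewrite ltr0n.
  set B : R := b.+1%:R in b0 e1 e2 *; set Cc : R := c.+1%:R in e1 e2 *.
  (* x^2 + y^2 = 2 (b+1) x on circle number b *)
  have h (D u v : R) : u ^+ 2 + v ^+ 2 = 1 ->
      (D * (1 - u)) ^+ 2 + (D * v) ^+ 2 = (2 * D) * (D * (1 - u)).
    move=> uv; have -> : (D * (1 - u)) ^+ 2 + (D * v) ^+ 2 =
      D ^+ 2 * (1 - 2 * u + (u ^+ 2 + v ^+ 2)) by ring.
    by rewrite uv; ring.
  have := h Cc _ _ cy; rewrite -e1 -e2 h // => /mulIf.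
  have nz : B * (1 - cos x) != 0 by rewrite mulf_neq0 ?(gt_eqF b0) // subr_eq0 eq_sym.
  by move=> /(_ nz) /mulfI; apply; rewrite pnatr_eq0.
have bc : b = c by move/eqP: e3; rewrite eqr_nat => /eqP [].
split=> //; move: e1 e2; rewrite e3.
have c0 : (c.+1%:R : R) != 0 by rewrite pnatr_eq0.
move=> /(mulfI c0) e1 /(mulfI c0) e2.
have ecos : cos x = cos y by lra.
have d0 : cos (x - y) = 1 by rewrite cosB ecos e2 -!expr2.
have /eqP : x - y = 0.
  apply: (cos_eq1_small _ d0); rewrite /x /y -mulrBr normrM ger0_norm; [rewrite gtr_pMr; [rewrite ltr_norml; lra | lra]|lra].
have nz : 2 * pi != 0 :> R by rewrite mulf_neq0 ?pnatr_eq0 ?gt_eqF.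
by rewrite subr_eq0 => /eqP /(mulfI nz).
Qed.

Lemma E_continuous b : continuous (E b : R -> R * R).
Proof.
move=> s.
have lin : 2 * pi * t @[t --> s] --> 2 * pi * s by exact: mulrl_continuous.
have hc : cos (2 * pi * t) @[t --> s] --> cos (2 * pi * s).
  apply: (continuous_cvg _ _ lin); exact: continuous_cos.
have hs : sin (2 * pi * t) @[t --> s] --> sin (2 * pi * s).
  apply: (continuous_cvg _ _ lin); exact: continuous_sin.
rewrite /continuous_at /E.
apply: (@cvg_pair _ _ _ _ (nbhs (b.+1%:R * (1 - cos (2 * pi * s)) : R))
          (nbhs (b.+1%:R * sin (2 * pi * s) : R))).
  by apply: cvgMl_tmp; apply: cvgB => //; exact: cvg_cst.
exact: cvgMl_tmp.
Qed.

Lemma Wedge_E k b s : (b < k)%N -> Wedge k (E b s).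
Proof. by move=> bk; exists b, s. Qed.

Lemma E_addz b s (z : int) : E b (s + z%:~R) = E b s.
Proof.
have h (x : R) : E b (x + 1) = E b x.
  have e : 2 * pi * (x + 1) = 2 * pi * x + pi *+ 2.
    by rewrite mulrDr mulr1 (mulr_natl pi 2).
  by rewrite /E e cosD2pi sinD2pi.
have hn (n : nat) (x : R) : E b (x + n%:R) = E b x.
  by elim: n => [|n IH]; rewrite ?addr0// -natr1 addrA h.
case: z => n; first exact: hn.
by rewrite NegzE mulrNz -(hn n.+1 (s - _)) pmulrn subrK.
Qed.

Lemma WedgeP k (z : R * R) : Wedge k z ->
  exists b s, [/\ (b < k)%N, 0 <= s < 1 & z = E b s].
Proof.
move=> [b [s [bk ->]]]; exists b, (s - (Num.floor s)%:~R); split=> //.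
  by have := floor_itv s; rewrite intrD => /andP[h1 h2]; apply/andP; split; lra.
by rewrite -rmorphN E_addz.
Qed.

(** Every map of this development is piecewise affine along orbits, so [opli] only has to be checked
    on one-sided affine pieces of positive slope. *)
Lemma opli_affine k (g : R -> R * R) (I : set R) :
  (forall t0, I t0 -> exists d : R, 0 < d /\
     [set t | t0 - d <= t <= t0 + d] `<=` I) ->
  (forall t0, I t0 -> exists d : R, 0 < d /\ exists c a e, [/\ (c < k)%N, 0 < a &
     forall t, t0 - d <= t <= t0 -> g t = E c (a * t + e)]) ->
  (forall t0, I t0 -> exists d : R, 0 < d /\ exists c a e, [/\ (c < k)%N, 0 < a &
     forall t, t0 <= t <= t0 + d -> g t = E c (a * t + e)]) ->
  opli k g I.
Proof.
have aff (a e : R) A : 0 < a ->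
    {within A, continuous (fun t => a * t + e)} /\ incr_on (fun t => a * t + e) A.
  move=> a0; split; last by move=> x y _ _ xy; rewrite ltrD2r ltr_pM2l.
  apply: continuous_subspaceT => x; apply: cvgD; last exact: cvg_cst.
  exact: mulrl_continuous.
move=> oI L Rr t0 It0; have [d1 [d10 sI]] := oI _ It0.
have [d2 [d20 [c [a [e [ck a0 gL]]]]]] := L _ It0.
have [d3 [d30 [c' [a' [e' [ck' a0' gR]]]]]] := Rr _ It0.
pose d := Num.min d1 (Num.min d2 d3).
have dd1 : d <= d1 by rewrite /d ge_min lexx.
have dd2 : d <= d2 by rewrite /d !ge_min lexx orbT.
have dd3 : d <= d3 by rewrite /d !ge_min lexx !orbT.
exists d; split; first by rewrite /d !lt_min d10 d20.
split; first by move=> t /= ht; apply: sI => /=; lra.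
exists c, c', (fun t => a * t + e), (fun t => a' * t + e'); split=> //.
  by have [] := aff a e [set t | t0 - d <= t <= t0] a0; split=> // t ht; apply: gL; lra.
by have [] := aff a' e' [set t | t0 <= t <= t0 + d] a0'; split=> // t ht; apply: gR; lra.
Qed.

End Circles.

(** * Compactness arguments in filter form *)

Section CompactNear.
Variable X : topologicalType.

(** Exchange of quantifiers over a compact set: with [F] a neighbourhood filter this is the tube
    lemma, with [F] the filter at infinity it yields uniform bounds. *)
Lemma compact_near (K : set X) (I : Type) (F : set_system I) (P : I -> X -> Prop) :
  compact K -> Filter F ->
  (forall x, K x -> exists A B, [/\ nbhs x A, F B &
     forall x' i, K x' -> A x' -> B i -> P i x']) ->
  F [set i | forall x, K x -> P i x].
Proof.
move=> /compact_near_coveringP/near_covering_withinP cK FF h.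
apply: (cK I F P FF) => x Kx; have [A [B [nA FB AB]]] := h _ Kx.
by exists (A, B) => //= -[x' i] /= [? ?] ?; apply: AB.
Qed.

Lemma hausdorff_sep : hausdorff_space X -> forall x y : X, x <> y ->
  exists A B, [/\ nbhs x A, nbhs y B & forall z, A z -> B z -> False].
Proof.
rewrite open_hausdorff => hX x y /eqP /hX [[A B] /= [xA yB] [oA oB /eqP/seteqP[AB0 _]]].
exists A, B; split.
- by apply: open_nbhs_nbhs; split=> //; rewrite inE in xA.
- by apply: open_nbhs_nbhs; split=> //; rewrite inE in yB.
- by move=> z Az Bz; apply: (AB0 z).
Qed.

Lemma compact_finite_cover (K : set X) (V : X -> set X) :
  compact K -> (forall x, K x -> nbhs x (V x)) ->
  exists s : seq X, (forall y, List.In y s -> K y) /\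
    forall x, K x -> exists y, List.In y s /\ V y x.
Proof.
move=> cK nV.
(* Tails of the finite lists in [K] ordered by inclusion: adding one point [x] to the list is an
   eventual condition. *)
pose F : set_system (seq X) := [set A | exists s0, (forall y, List.In y s0 -> K y) /\
  forall s, (forall y, List.In y s -> K y) ->
   (forall y, List.In y s0 -> List.In y s) -> A s].
have FF : Filter F.
  split.
  - by exists [::].
  - move=> P Q [s0 [s0K P0]] [s1 [s1K Q1]]; exists (s0 ++ s1); split.
      by move=> y /List.in_app_iff [/s0K|/s1K].
    by move=> s sK h; split; [apply: P0|apply: Q1] => // y ys;
      apply: h; apply/List.in_app_iff; [left|right].
  - by move=> P Q PQ [s0 [? h]]; exists s0; split=> // s sK hs; apply/PQ/h.
have [s [sK h]] : F [set s | forall x, K x -> exists y, List.In y s /\ V y x].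
  apply: compact_near => // x Kx; exists (V x), [set s | List.In x s].
  split; [exact: nV| |by move=> z s _ Vz xs; exists x].
  by exists [:: x]; split=> [y [<-//|//]|s _ h]; apply: h; left.
by exists s; split=> //; apply: h.
Qed.

End CompactNear.

(** * Kakutani-Rokhlin towers of a homeomorphism of a compact zero-dimensional set *)

Section CantorSystem.
Variables (X : topologicalType) (C : set X).
Implicit Types (y z : X).

(** Functions are defined on all of [X] and constrained on [C] only; a locally constant [X -> bool]
    plays the role of a clopen subset of [C]. *)
Definition loc_const (A : Type) (g : X -> A) :=
  forall y, C y -> \forall z \near y, C z -> g z = g y.

Lemma loc_const_cst (A : Type) (a : A) : loc_const (fun _ => a).
Proof. by move=> y _; near=> z. Unshelve. all: by end_near. Qed.

Lemma loc_const_comp (A B : Type) (F : A -> B) (g : X -> A) :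
  loc_const g -> loc_const (fun y => F (g y)).
Proof. by move=> lg y Cy; apply: filterS (lg y Cy) => z gz Cz; rewrite gz. Qed.

Lemma loc_const_pair (A B : Type) (g : X -> A) (h : X -> B) :
  loc_const g -> loc_const h -> loc_const (fun y => (g y, h y)).
Proof.
move=> lg lh y Cy; apply: filterS2 (lg y Cy) (lh y Cy) => z gz hz Cz.
by rewrite gz ?hz.
Qed.

Lemma loc_const_dep (A B : Type) (n : X -> A) (g : A -> X -> B) :
  loc_const n -> (forall a, loc_const (g a)) -> loc_const (fun y => g (n y) y).
Proof.
move=> ln lg y Cy; apply: filterS2 (ln y Cy) (lg (n y) y Cy) => z nz gz Cz.
by rewrite nz // gz.
Qed.

Lemma loc_const_map (A B : Type) (s : seq A) (g : A -> X -> B) :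
  (forall a, loc_const (g a)) -> loc_const (fun y => [seq g a y | a <- s]).
Proof.
move=> lg; elim: s => [|a s IH] /=; first exact: loc_const_cst.
exact: (loc_const_comp (fun p => p.1 :: p.2) (loc_const_pair (lg a) IH)).
Qed.

Hypothesis Ccpt : compact C.

Lemma loc_const_finite (A : eqType) (g : X -> A) : loc_const g ->
  exists s : seq A, forall y, C y -> g y \in s.
Proof.
move=> lg; have [s [_ sP]] := compact_finite_cover Ccpt lg.
exists [seq g y | y <- s] => y Cy; have [z [zs gz]] := sP _ Cy.
rewrite (gz Cy); elim: s zs {sP} => //= a s IH [->|/IH zs]; rewrite inE ?eqxx//.
by rewrite zs orbT.
Qed.

Hypothesis X_hausdorff : hausdorff_space X.
Variables (T : X -> X) (xb : X).
Hypothesis Cxb : C xb.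
Hypothesis TC : forall y, C y -> C (T y).
Hypothesis T_inj : forall y z, C y -> C z -> T y = T z -> y = z.
Hypothesis T_surj : forall y, C y -> exists2 z, C z & T z = y.
Hypothesis T_cont : forall y N, C y -> nbhs (T y) N ->
  \forall z \near y, C z -> N (T z).
Hypothesis T_hits : forall y N, C y -> nbhs xb N ->
  exists n, C (iter n.+1 T y) /\ N (iter n.+1 T y).
Hypothesis C_zd : forall y N, C y -> nbhs y N ->
  exists d : X -> bool, [/\ loc_const d, d y & forall z, C z -> d z -> N z].

Definition Tinv y := xget y [set z | C z /\ T z = y].

Lemma TinvP y : C y -> C (Tinv y) /\ T (Tinv y) = y.
Proof.
move=> Cy; rewrite /Tinv; case: xgetP => [z -> //|].
by have [z Cz Tz] := T_surj Cy => /(_ z) [].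
Qed.

Lemma TinvK y : C y -> Tinv (T y) = y.
Proof. by move=> Cy; have [? ?] := TinvP (TC Cy); apply: T_inj. Qed.

Lemma loc_const_T (A : Type) (g : X -> A) : loc_const g -> loc_const (g \o T).
Proof.
move=> lg y Cy; apply: filterS (T_cont Cy (lg _ (TC Cy))) => z h Cz.
by apply: h => //; apply: TC.
Qed.

(** A continuous bijection of a compact Hausdorff space has a continuous inverse: if [T z] differs
    from [y], separation keeps the images of points near [z] away from [y], uniformly by
    compactness. *)
Lemma loc_const_Tinv (A : Type) (g : X -> A) :
  loc_const g -> loc_const (g \o Tinv).
Proof.
move=> lg y Cy; have [CSy TSy] := TinvP Cy.
have : \forall w \near y, forall z, C z -> T z = w -> g z = g (Tinv y).
  apply: compact_near => // z Cz; have [Tzy|Tzy] := pselect (T z = y).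
    exists [set z' | C z' -> g z' = g z], setT; split=> //; [exact: lg|exact: filterT|].
    by rewrite -Tzy TinvK // => z' w Cz' h _ _; apply: h.
  have [N1 [N2 [n1 n2 n12]]] := hausdorff_sep X_hausdorff Tzy.
  exists [set z' | C z' -> N1 (T z')], N2; split=> //; first exact: T_cont.
  by move=> z' w Cz' h N2w Tw; case: (n12 w) => //; rewrite -Tw; apply: h.
by apply: filterS => w h Cw; have [? ?] := TinvP Cw; apply: h.
Qed.

Lemma T_iter n y : C y -> C (iter n T y).
Proof. by move=> Cy; elim: n => //= n /TC. Qed.

Lemma Tinv_iter n y : C y -> C (iter n Tinv y).
Proof. by move=> Cy; elim: n => //= n /TinvP []. Qed.

Lemma iter_TinvK n y : C y -> iter n T (iter n Tinv y) = y.
Proof.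
elim: n y => //= n IH y Cy; rewrite -iterS iterSr.
have /TinvP[_ ->] := Tinv_iter n Cy; exact: IH.
Qed.

Lemma loc_const_iter_T (A : Type) (g : X -> A) n :
  loc_const g -> loc_const (fun y => g (iter n T y)).
Proof.
move=> lg; elim: n => //= n IH.
have := loc_const_T IH; congr loc_const; apply/funext => y /=.
by rewrite -iterSr.
Qed.

Lemma loc_const_iter_Tinv (A : Type) (g : X -> A) n :
  loc_const g -> loc_const (fun y => g (iter n Tinv y)).
Proof.
move=> lg; elim: n => //= n IH.
have := loc_const_Tinv IH; congr loc_const; apply/funext => y /=.
by rewrite -iterSr.
Qed.

(** Hitting [d] at a given time is an open condition on the starting point, so compactness of [C]
    bounds the hitting times. *)
Lemma uniform_hit (d : X -> bool) : loc_const d -> d xb ->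
  exists M, forall y, C y -> exists2 n, (n < M)%N & d (iter n.+1 T y).
Proof.
move=> ld dxb.
have h : forall y, C y -> exists n, d (iter n.+1 T y).
  move=> y Cy; have [n [Cn dn]] := T_hits Cy (ld _ Cxb).
  by exists n; rewrite dn.
have : \forall M \near \oo, forall y, C y -> exists2 n, (n < M)%N & d (iter n.+1 T y).
  apply: compact_near => // y Cy; have [n dn] := h _ Cy.
  exists [set z | C z -> d (iter n.+1 T z) = d (iter n.+1 T y)], [set M | (n < M)%N].
  split.
  - by have := loc_const_iter_T n.+1 ld; apply.
  - by exists n.+1.
  - by move=> z M Cz dz nM; exists n => //; rewrite dz.
by move=> [M _ hM]; exists M; apply: (hM M) => /=.
Qed.


(* Kakutani-Rokhlin towers over the clopen set [d]: the point [y] lies at height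
   [j y] of tower number [b y], which has [L y] floors. *)
Record tower (d : X -> bool) (k : nat) (b j L : X -> nat) : Prop := Tower {
  tower_lc : loc_const (fun y => (b y, j y, L y));
  tower_lt : forall y, C y -> (b y < k)%N;
  tower_surj : forall c, (c < k)%N -> exists y, [/\ C y, d y & b y = c];
  tower_height : forall y, C y -> (j y < L y)%N;
  tower_floor0 : forall y, C y -> (j y == 0)%N = d y;
  tower_up : forall y, C y -> ~~ d (T y) ->
    [/\ b (T y) = b y, L (T y) = L y & j (T y) = (j y).+1];
  tower_top : forall y, C y -> d (T y) -> (j y).+1 = L y;
  tower_label : forall y z, C y -> C z -> b y = b z -> L y = L z }.

Lemma find_iota_lt (P : pred nat) M n : (n < M)%N -> P n ->
  (find P (iota 0 M) < M)%N /\ P (find P (iota 0 M)).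
Proof.
move=> nM Pn.
have hP : has P (iota 0 M) by apply/hasP; exists n => //; rewrite mem_iota.
have lt : (find P (iota 0 M) < M)%N by rewrite -[X in (_ < X)%N](size_iota 0 M) -has_find.
by split=> //; have := nth_find 0%N hP; rewrite nth_iota.
Qed.

Lemma find_iota_before (P : pred nat) M n : (n < find P (iota 0 M))%N -> P n = false.
Proof.
move=> nf; have := before_find 0%N nf; rewrite nth_iota //.
by apply: leq_trans nf _; rewrite -[X in (_ <= X)%N](size_iota 0 M) find_size.
Qed.

Lemma find_iota_eq (P : pred nat) M n : (n < M)%N -> P n ->
  (forall i, (i < n)%N -> P i = false) -> find P (iota 0 M) = n.
Proof.
move=> nM Pn h; have [_ Pf] := find_iota_lt nM Pn.
case: (ltngtP (find P (iota 0 M)) n) => [/h|/find_iota_before|//]; first by rewrite Pf.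
by rewrite Pn.
Qed.

(** Towers are indexed by the itinerary of [code] along a whole column. The length of this word is
    the height of the tower, and its entry number [j y] is [code y]. *)
Lemma tower_exists (d : X -> bool) (code : X -> nat) :
  loc_const d -> d xb -> loc_const code ->
  exists k b j L, tower d k b j L /\
    forall y z, C y -> C z -> b y = b z -> j y = j z -> code y = code z.
Proof.
move=> ld dxb lcode; have [M hM] := uniform_hit ld dxb.
(* The next visit of [y] to [d] is at time [(fw y).+1], the latest one [j y] steps back; [j] may be
   0 while the forward time is positive. *)
pose fw y := find (fun n => d (iter n.+1 T y)) (iota 0 M).
pose j y := find (fun n => d (iter n Tinv y)) (iota 0 M).
pose L y := (j y + (fw y).+1)%N.
pose word y := [seq code (iter n T (iter (j y) Tinv y)) | n <- iota 0 (L y)].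
have fwP y : C y -> (fw y < M)%N /\ d (iter (fw y).+1 T y).
  by move=> Cy; have [n nM dn] := hM _ Cy; apply: find_iota_lt dn.
have jP y : C y -> (j y < M)%N /\ d (iter (j y) Tinv y).
  (* A past visit is found by going back [M] steps and using the forward bound from there. *)
  move=> Cy; have [n nM dn] := hM _ (Tinv_iter M Cy).
  apply: (@find_iota_lt _ _ (M - n.+1)); first lia.
  have e : iter (M - n.+1) Tinv y = iter n.+1 T (iter M Tinv y).
    have {2}-> : M = (n.+1 + (M - n.+1))%N by lia.
    by rewrite iterD iter_TinvK //; apply: Tinv_iter.
  by rewrite e.
have lj : loc_const j.
  have := @loc_const_map _ _ (iota 0 M) _ (fun n => loc_const_iter_Tinv n ld).
  move=> /(loc_const_comp (find id)); congr loc_const; apply/funext => y.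
  by rewrite find_map.
have lfw : loc_const fw.
  have := @loc_const_map _ _ (iota 0 M) _ (fun n => loc_const_iter_T n.+1 ld).
  move=> /(loc_const_comp (find id)); congr loc_const; apply/funext => y.
  by rewrite find_map.
have lL : loc_const L.
  exact: (loc_const_comp (fun p => (p.1 + p.2.+1)%N) (loc_const_pair lj lfw)).
have lword : loc_const word.
  have := @loc_const_dep _ _ _ (fun (p : nat * nat) y =>
     [seq code (iter n T (iter p.1 Tinv y)) | n <- iota 0 p.2]) (loc_const_pair lj lL).
  apply => -[p q] /=; apply: loc_const_map => n.
  exact: (loc_const_iter_Tinv p (loc_const_iter_T n lcode)).
have [ws0 ws0P] := loc_const_finite lword.
(* Only words read from a base point are kept, once each, so that every index names a nonempty
   tower. *)
pose ws := undup [seq w <- ws0 | `[< exists y, [/\ C y, d y & word y = w] >]].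
pose b y := index (word y) ws.
have j0 y : C y -> (j y == 0)%N = d y.
  move=> Cy; have [jM dj] := jP _ Cy; apply/eqP/idP => [e|dy]; first by rewrite e in dj.
  by apply: find_iota_eq => //; lia.
have up y : C y -> ~~ d (T y) -> j (T y) = (j y).+1 /\ (fw y) = (fw (T y)).+1.
  move=> Cy nd; have [jM dj] := jP _ (TC Cy); have [jM' dj'] := jP _ Cy.
  have [fM df] := fwP _ Cy; have [fM' df'] := fwP _ (TC Cy).
  have jT : j (T y) = (j (T y)).-1.+1.
    by rewrite prednK // lt0n j0 //; apply: TC.
  have fw1 : fw y = (fw y).-1.+1.
    rewrite prednK // lt0n; apply/negP => /eqP e; by rewrite e /= (negbTE nd) in df.
  split.
    rewrite jT; congr S; apply/esym/find_iota_eq; first by lia.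
      by rewrite jT iterSr TinvK // in dj.
    move=> i ij; have : (i.+1 < j (T y))%N by lia.
    by move=> /find_iota_before; rewrite iterSr TinvK.
  rewrite fw1; congr S; apply/esym/find_iota_eq; first by lia.
    by rewrite -iterSr -fw1.
  move=> i ij; have : (i.+1 < fw y)%N by lia.
  by move=> /find_iota_before; rewrite -iterSr.
have base y : C y -> ~~ d (T y) -> iter (j (T y)) Tinv (T y) = iter (j y) Tinv y.
  by move=> Cy nd; have [-> _] := up _ Cy nd; rewrite iterSr TinvK.
have LT y : C y -> ~~ d (T y) -> L (T y) = L y.
  by move=> Cy nd; have [h e] := up _ Cy nd; rewrite /L h e; lia.
have wT y : C y -> ~~ d (T y) -> word (T y) = word y.
  by move=> Cy nd; rewrite /word base // LT.
have wb y : C y -> exists z, [/\ C z, d z & word z = word y].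
  move En : (j y) => n; elim: n y En => [|n IH] y jy Cy.
    by exists y; split=> //; rewrite -j0 ?jy.
  have [CS TS] := TinvP Cy.
  have nd : ~~ d (T (Tinv y)) by rewrite TS -j0 ?jy.
  have [] := up _ CS nd; rewrite TS jy => -[/esym /IH /(_ CS) [z [Cz dz wz]]] _.
  by exists z; split=> //; rewrite wz -(wT _ CS nd) TS.
have wsP y : C y -> word y \in ws.
  by move=> Cy; rewrite mem_undup mem_filter ws0P // andbT; apply/asboolP/wb.
exists (size ws), b, j, L; split; first split.
- apply: loc_const_pair => //; apply: loc_const_pair => //.
  exact: (loc_const_comp (fun w => index w ws) lword).
- by move=> y Cy; rewrite index_mem wsP.
- move=> c ck; have : nth [::] ws c \in ws by rewrite mem_nth.
  rewrite mem_undup mem_filter => /andP[/asboolP[y [Cy dy wy]] _].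
  by exists y; split=> //; rewrite /b wy index_uniq // undup_uniq.
- by move=> y Cy; rewrite /L addnS ltnS leq_addr.
- exact: j0.
- by move=> y Cy nd; split; [rewrite /b wT|rewrite LT|have [] := up _ Cy nd].
- move=> y Cy dT; rewrite /L addnS; congr S.
  suff -> : fw y = 0%N by rewrite addn0.
  by apply: find_iota_eq => //; have [hM' _] := fwP _ Cy; lia.
- move=> y z Cy Cz; rewrite /b => e.
  have {}e : word y = word z by exact: (index_inj [::] (wsP _ Cy) (wsP _ Cz) e).
  by have := congr1 size e; rewrite !size_map !size_iota.
- move=> y z Cy Cz; rewrite /b => e.
  have {}e : word y = word z by exact: (index_inj [::] (wsP _ Cy) (wsP _ Cz) e).
  have wj x : C x -> nth 0%N (word x) (j x) = code x.
    move=> Cx; rewrite (nth_map 0%N) ?size_iota; last by rewrite /L; lia.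
    by rewrite nth_iota ?iter_TinvK //; rewrite /L; lia.
  by move=> jj; rewrite -wj // -[RHS]wj // e jj.
Qed.


Lemma tower_orbit d k b j L : tower d k b j L ->
  forall y i, C y -> d y -> (i < L y)%N ->
  [/\ j (iter i T y) = i, b (iter i T y) = b y, L (iter i T y) = L y &
      (0 < i)%N -> ~~ d (iter i T y)].
Proof.
move=> tw y i Cy dy; elim: i => [|i IH] iL.
  by split=> //=; apply/eqP; rewrite (tower_floor0 tw).
have [ji bi Li _] := IH (ltnW iL); have Ci := T_iter i Cy.
have nd : ~~ d (T (iter i T y)).
  by apply/negP => /(tower_top tw Ci); rewrite ji Li => e; rewrite e ltnn in iL.
by have [-> -> ->] := tower_up tw Ci nd; rewrite ji.
Qed.

Lemma tower_return d k b j L : tower d k b j L ->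
  forall y, C y -> d y -> d (iter (L y) T y).
Proof.
move=> tw y Cy dy; have L0 := tower_height tw Cy.
have iL : ((L y).-1 < L y)%N by lia.
have [ji bi Li _] := tower_orbit tw Cy dy iL.
rewrite (_ : L y = (L y).-1.+1); last by lia.
apply/negP => /negP nd; have [_ LT jT] := tower_up tw (T_iter _ Cy) nd.
by have := tower_height tw (TC (T_iter (L y).-1 Cy)); rewrite LT jT ji Li; lia.
Qed.

Record level := Level {
  lv_d : X -> bool; lv_k : nat; lv_b : X -> nat; lv_j : X -> nat; lv_L : X -> nat }.

Definition level_ok l := [/\ loc_const (lv_d l), lv_d l xb &
  tower (lv_d l) (lv_k l) (lv_b l) (lv_j l) (lv_L l)].

(** [ref_first] and [ref_last] give the common end letters of the bonding words; [ref_proper]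
    forbids an [l']-tower made of a single [l]-tower. [ref_code] lets level [l'] determine level [l]
    off the wedge point, and [ref_sub] with [ref_base] does so at it. *)
Record refines (g : X -> nat) (l l' : level) : Prop := Refines {
  ref_sub : forall y, C y -> lv_d l' y -> lv_d l y;
  ref_first : forall y, C y -> lv_d l' y -> lv_b l y = lv_b l xb;
  ref_last : forall y, C y -> lv_d l' (T y) -> lv_b l y = lv_b l (Tinv xb);
  ref_proper : (forall i, (0 < i)%N -> iter i T xb <> xb) ->
    forall y, C y -> lv_d l' y -> ~~ lv_d l' (iter (lv_L l y) T y);
  ref_code : forall y z, C y -> C z ->
    lv_b l' y = lv_b l' z -> lv_j l' y = lv_j l' z ->
    [/\ lv_b l y = lv_b l z, lv_j l y = lv_j l z & g y = g z];
  ref_base : forall y, C y -> lv_d l' y -> g y = g xb }.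

Lemma loc_const_andb (d e : X -> bool) :
  loc_const d -> loc_const e -> loc_const (fun y => d y && e y).
Proof.
by move=> ld le; apply: (loc_const_comp (fun p => p.1 && p.2) (loc_const_pair ld le)).
Qed.

(** The new base is a finite intersection of clopen conditions, each true at [xb]; the new code
    records the old tower data together with [g]. *)
Lemma refines_exists g l : loc_const g -> level_ok l ->
  exists l', level_ok l' /\ refines g l l'.
Proof.
move=> lg [ld dxb tw]; have lt := tower_lc tw.
have lb : loc_const (lv_b l) by exact: (loc_const_comp (fun p => p.1.1) lt).
(* Unless [xb] is periodic, [e] is a clopen neighbourhood of [xb] disjoint from its image under one
   iterate of [T]. The height at [xb] is the right exponent for the whole new base, since [lv_b l],
   hence [lv_L l], is constant there. *)
have [e [le exb eP]] : exists e : X -> bool, [/\ loc_const e, e xb &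
    (forall i, (0 < i)%N -> iter i T xb <> xb) ->
    forall y, C y -> e y -> ~~ e (iter (lv_L l xb) T y)].
  have [ap|nap] := pselect (forall i, (0 < i)%N -> iter i T xb <> xb); last first.
    by exists xpredT; split=> //; exact: loc_const_cst.
  have L0 := tower_height tw Cxb.
  have L1 : (0 < lv_L l xb)%N by lia.
  have [A [B [nA nB AB]]] := hausdorff_sep X_hausdorff (ap _ L1).
  have [d2 [ld2 d2x d2P]] := C_zd (T_iter _ Cxb) nA.
  have [d1 [ld1 d1x d1P]] := C_zd Cxb nB.
  exists (fun y => d1 y && d2 (iter (lv_L l xb) T y)); split.
  - exact: loc_const_andb ld1 (loc_const_iter_T _ ld2).
  - by rewrite d1x.
  - move=> _ y Cy /andP[d1y d2y]; apply/negP => /andP[d1T _].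
    by apply: (AB (iter (lv_L l xb) T y)); [apply: d2P|apply: d1P] => //; apply: T_iter.
pose d' y := [&& lv_d l y, lv_b l y == lv_b l xb,
  lv_b l (Tinv y) == lv_b l (Tinv xb), g y == g xb & e y].
have ld' : loc_const d'.
  apply: loc_const_andb => //; apply: loc_const_andb.
    exact: (loc_const_comp (fun n => n == _) lb).
  apply: loc_const_andb.
    exact: (loc_const_comp (fun n => n == _) (loc_const_Tinv lb)).
  apply: loc_const_andb => //; exact: (loc_const_comp (fun n => n == _) lg).
have d'xb : d' xb by rewrite /d' dxb exb !eqxx.
have lcode : loc_const (fun y => pickle (lv_b l y, lv_j l y, lv_L l y, g y)).
  exact: (loc_const_comp pickle (loc_const_pair lt lg)).
have [k [b [j [L [tw' code]]]]] := tower_exists ld' d'xb lcode.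
exists (Level d' k b j L); split; first by split.
split=> /=.
- by move=> y _ /andP[].
- by move=> y _ /and5P[_ /eqP].
- by move=> y Cy /and5P[_ _ /eqP]; rewrite TinvK.
- move=> ap y Cy /and5P[dy /eqP by_ _ _ ey].
  have -> : lv_L l y = lv_L l xb by apply: (tower_label tw).
  by apply/negP => /and5P[_ _ _ _]; apply/negP/eP.
- move=> y z Cy Cz bb jj; have := code _ _ Cy Cz bb jj.
  by move=> /(pcan_inj pickleK) [].
- by move=> y _ /and5P[_ _ _ /eqP].
Qed.

Lemma levels_exist (g : nat -> X -> nat) (d0 : X -> bool) :
  (forall n, loc_const (g n)) -> loc_const d0 -> d0 xb ->
  exists l : nat -> level, [/\ lv_d (l 0%N) = d0, forall n, level_ok (l n) &
    forall n, refines (g n) (l n) (l n.+1)].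
Proof.
move=> lg ld0 d0x.
have [k [b [j [L [tw _]]]]] := tower_exists ld0 d0x (loc_const_cst 0%N).
(* The state carries its index because step [n] has to use the label [g n]. *)
pose S := {p : nat * level | level_ok p.2}.
pose Rel (p q : S) := (sval q).1 = (sval p).1.+1 /\
  refines (g (sval p).1) (sval p).2 (sval q).2.
have step (p : S) : {q : S | Rel p q}.
  apply: cid; case: p => -[n l] /= okl.
  have [l' [okl' ref]] := refines_exists (lg n) okl.
  by exists (exist _ (n.+1, l') okl').
have ok0 : level_ok (0%N, Level d0 k b j L).2 by [].
have [f [f0 fS]] := dependent_choice step (exist (fun p : nat * level => level_ok p.2) (0%N, _) ok0).
have fn n : (sval (f n)).1 = n.
  by elim: n => [|n IH]; [rewrite f0|have [-> _] := fS n; rewrite IH].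
exists (fun n => (sval (f n)).2); split.
- by rewrite f0.
- by move=> n; exact: (svalP (f n)).
- by move=> n; have [_] := fS n; rewrite fn.
Qed.

(** The orbit of [xb] is finite here, so finitely many separations isolate [xb] in it; larger
    exponents reduce modulo [N.+1]. *)
Lemma periodic_clopen N : iter N.+1 T xb = xb ->
  exists d : X -> bool, [/\ loc_const d, d xb &
    forall i, d (iter i T xb) -> iter i T xb = xb].
Proof.
move=> per.
have [d [ld dx dP]] : exists d : X -> bool, [/\ loc_const d, d xb &
    forall i, (i < N.+1)%N -> d (iter i T xb) -> iter i T xb = xb].
  elim: N.+1 => [|m [d [ld dx dP]]]; first by exists xpredT; split=> //; exact: loc_const_cst.
  have [mx|mx] := pselect (iter m T xb = xb).
    exists d; split=> // i; rewrite ltnS leq_eqVlt => /orP[/eqP ->|] //; exact: dP.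
  have [A [B [nA nB AB]]] := hausdorff_sep X_hausdorff mx.
  have [d1 [ld1 d1x d1P]] := C_zd Cxb nB.
  exists (fun y => d y && d1 y); split.
  - exact: loc_const_andb.
  - by rewrite dx.
  - move=> i; rewrite ltnS leq_eqVlt => /orP[/eqP ->|im] /andP[d0 d1i]; last exact: dP.
    by case: (AB (iter m T xb)); [exact: nbhs_singleton|apply: d1P => //; exact: T_iter].
exists d; split=> // i.
have pm q : iter (q * N.+1) T xb = xb by elim: q => // q IH; rewrite mulSn iterD IH.
have -> : iter i T xb = iter (i %% N.+1) T xb.
  by rewrite {1}(divn_eq i N.+1) addnC iterD pm.
by apply: dP; rewrite ltn_mod.
Qed.

End CantorSystem.

(** A continuous map from a compact set to a Hausdorff space is a quotient map onto its image. This
    gives continuity both of the projections, defined on a suspension, and of the bonding maps,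
    defined through preimages. *)
Lemma quotient_continuous (Y X Z : topologicalType) (K : set Y) (Phi : Y -> X)
    (h : X -> Z) :
  compact K -> hausdorff_space X ->
  (forall y N, K y -> nbhs (Phi y) N -> \forall y' \near y, K y' -> N (Phi y')) ->
  (forall y N, K y -> nbhs (h (Phi y)) N ->
     \forall y' \near y, K y' -> N (h (Phi y'))) ->
  forall x N, nbhs (h x) N -> \forall x' \near x, (Phi @` K) x' -> N (h x').
Proof.
move=> cK hX cPhi chP x N nN.
have : \forall x' \near x, forall y, K y -> Phi y = x' -> N (h x').
  apply: compact_near => // y Ky; have [Py|Py] := pselect (Phi y = x).
    exists [set y' | K y' -> N (h (Phi y'))], setT; split.
    - by apply: chP => //; rewrite Py.
    - exact: filterT.
    - by move=> y' x' Ky' Ny' _ <-; apply: Ny'.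
  have [A [B [nA nB AB]]] := hausdorff_sep hX Py.
  exists [set y' | K y' -> A (Phi y')], B; split=> //; first exact: cPhi.
  by move=> y' x' Ky' Ay' Bx' e; case: (AB x') => //; rewrite -e; apply: Ay'.
by apply: filterS => x' h' [y Ky]; exact: h'.
Qed.

(* A cross-section [C] of the flow through [xb], with first return time [r];
   [eps] bounds the return times from below. *)
Record transversal (R : realType) (X : topologicalType) (act : R -> X -> X)
    (xb : X) (C : set X) (r : X -> R) (eps : R) : Prop := Transversal {
  tr_closed : closed C;
  tr_base : C xb;
  tr_eps : 0 < eps;
  tr_eps_le : forall y, C y -> eps <= r y;
  tr_ret : forall y, C y -> C (act (r y) y);
  tr_first : forall y (t : R), C y -> 0 < t < r y -> ~ C (act t y);
  tr_cover : forall x, exists y (t : R), [/\ C y, 0 <= t < r y & x = act t y];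
  tr_cont : forall y (e : R), C y -> 0 < e -> \forall z \near y, C z -> `|r z - r y| < e;
  tr_zd : forall y N, C y -> nbhs y N ->
    exists D, [/\ D y, D `<=` N `&` C, closed D & closed (C `\` D)];
  tr_hit : forall x N, nbhs xb N -> exists t : R, [/\ 0 < t, C (act t x) & N (act t x)] }.

(** * The first return map of a cross-section *)

Section FlowTransversal.
Variables (R : realType) (X : topologicalType) (act : R -> X -> X).
Hypothesis X_compact : compact [set: X].
Hypothesis X_hausdorff : hausdorff_space X.
Hypothesis act_continuous : continuous (fun q : R * X => act q.1 q.2).
Hypothesis act0 : forall x, act 0 x = x.
Hypothesis actD : forall s t x, act (s + t) x = act s (act t x).

Lemma act_near t x N : nbhs (act t x) N ->
  exists e : R, 0 < e /\ exists2 A, nbhs x A &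
    forall t' x', `|t - t'| < e -> A x' -> N (act t' x').
Proof.
move=> nN; have [[P Q] /= [/nbhs_ballP [e e0 sP] nQ] PQ] := @act_continuous (t, x) N nN.
by exists e; split=> //; exists Q => // t' x' tt' Qx'; apply: (PQ (t', x')); split=> //=; apply: sP.
Qed.

Lemma act_near2 t x N : nbhs (act t x) N -> \forall x' \near x, N (act t x').
Proof.
by move=> /act_near [e [e0 [A nA h]]]; apply: filterS nA => x' Ax'; apply: h; rewrite ?subrr ?normr0.
Qed.

Lemma actK t x : act (- t) (act t x) = x.
Proof. by rewrite -actD addNr act0. Qed.

Lemma act_eq_shift s t x y : act s x = act t y -> x = act (t - s) y.
Proof. by move=> e; rewrite addrC actD -e actK. Qed.

Variables (xb : X) (C : set X) (r : X -> R) (eps : R).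
Hypothesis tr : transversal act xb C r eps.

Let T y := act (r y) y.

Lemma sec_compact : compact C.
Proof. exact: subclosed_compact (tr_closed tr) X_compact _. Qed.

Lemma sec_rpos y : C y -> 0 < r y.
Proof. by move=> /(tr_eps_le tr); apply: lt_le_trans (tr_eps tr). Qed.

(** After flowing back by the smaller time, a difference of times would be a return to [C] strictly
    before the first return. *)
Lemma sec_uniq y z (t s : R) : C y -> C z -> 0 <= t < r y -> 0 <= s < r z ->
  act t y = act s z -> y = z /\ t = s.
Proof.
have W y' z' t' s' : C y' -> C z' -> t' <= s' -> 0 <= t' -> s' < r z' ->
    act t' y' = act s' z' -> y' = z' /\ t' = s'.
  move=> Cy Cz ts t0 sr e; have e' := act_eq_shift e.
  have st : s' = t'.
    apply/eqP/negPn/negP => st; apply: (@tr_first _ _ _ _ _ _ _ tr z' (s' - t')) => //.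
      by apply/andP; split; [rewrite subr_gt0 lt_neqAle eq_sym st|lra].
    by rewrite -e'.
  by split=> //; rewrite e' st subrr act0.
move=> Cy Cz ty sz e; case: (leP t s) => ts; first by apply: W => //; lra.
by have [] := W z y s t => //; lra.
Qed.

Lemma sec_T_inj y z : C y -> C z -> T y = T z -> y = z.
Proof.
have W y' z' : C y' -> C z' -> r y' <= r z' -> T y' = T z' -> y' = z'.
  move=> Cy Cz rr /act_eq_shift e.
  have := @sec_uniq y' z' 0 (r z' - r y') Cy Cz.
  have := sec_rpos Cy; rewrite act0 => ry h.
  by have [] := h _ _ e => //; lra.
move=> Cy Cz; case: (leP (r y) (r z)) => rr e; first exact: W.
by apply/esym/W => //; apply: ltW.
Qed.

Lemma sec_T_surj y : C y -> exists2 z, C z & T z = y.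
Proof.
move=> Cy; have e0 := tr_eps tr.
(* Going back by [eps / 2], less than any return time, leaves no choice: arriving before [r z]
   contradicts the first return of [z], arriving after it that of [T z]. *)
have [z [t [Cz tr0 e]]] := tr_cover tr (act (- (eps / 2)) y).
have {}e : y = act (t + eps / 2) z.
  by rewrite addrC actD -e -actD subrr act0.
exists z => //; have [lt|gt|rt] := ltgtP (t + eps / 2) (r z); last by rewrite e rt.
  by case: (@tr_first _ _ _ _ _ _ _ tr z (t + eps / 2)) => //; rewrite -?e //; lra.
case: (@tr_first _ _ _ _ _ _ _ tr (T z) (t + eps / 2 - r z)) => //.
- exact: tr_ret tr _ Cz.
- by have := tr_eps_le tr (tr_ret tr Cz); rewrite -/(T z); lra.
- by rewrite /T -actD subrK -e.
Qed.

Lemma sec_T_cont y N : C y -> nbhs (T y) N -> \forall z \near y, C z -> N (T z).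
Proof.
move=> Cy /act_near [e [e0 [A nA h]]].
apply: filterS2 (tr_cont tr Cy e0) nA => z rz Az Cz.
by apply: h => //; rewrite distrC; apply: rz.
Qed.

(** Each return costs at least [eps], which makes the induction on [n] decrease. *)
Lemma sec_hit_iter n y (t : R) : C y -> 0 < t -> t < n%:R * eps -> C (act t y) ->
  exists m, act t y = iter m.+1 T y.
Proof.
elim: n y t => [|n IH] y t Cy t0 tn Ct; first by lra.
have er := tr_eps_le tr Cy.
have [lt|gt|->] := ltgtP t (r y); last by exists 0%N.
  by case: (@tr_first _ _ _ _ _ _ _ tr y t) => //; rewrite t0.
have [||||m e] := IH (T y) (t - r y).
- exact: tr_ret tr _ Cy.
- by rewrite subr_gt0.
- by move: tn; rewrite -natr1 mulrDl; lra.
- by rewrite /T -actD subrK.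
by exists m.+1; rewrite iterSr -e /T -actD subrK.
Qed.

Lemma sec_T_hits y N : C y -> nbhs xb N ->
  exists n, C (iter n.+1 T y) /\ N (iter n.+1 T y).
Proof.
move=> Cy nN; have [t [t0 Ct Nt]] := tr_hit tr y nN.
have e0 := tr_eps tr.
have [|m e] := @sec_hit_iter (Num.truncn (t / eps)).+1 y t Cy t0 _ Ct.
  rewrite -ltr_pdivrMr //.
  by have /andP[] := truncn_itv (ltW (divr_gt0 t0 e0)).
by exists m; rewrite -e.
Qed.

Lemma sec_zd y N : C y -> nbhs y N ->
  exists d : X -> bool, [/\ loc_const C d, d y & forall z, C z -> d z -> N z].
Proof.
move=> Cy nN; have [D [Dy DN cD cCD]] := tr_zd tr Cy nN.
exists (fun z => `[< D z >]); split; last by move=> z _ /asboolP /DN [].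
  move=> z Cz; have [Dz|Dz] := pselect (D z).
    have : nbhs z (~` (C `\` D)).
      by apply: open_nbhs_nbhs; split; [exact: closed_openC|case].
    apply: filterS => w nw Cw; rewrite (asboolT Dz); apply/asboolP.
    by apply: contrapT => nD; apply: nw.
  have : nbhs z (~` D) by apply: open_nbhs_nbhs; split; [exact: closed_openC|].
  by apply: filterS => w nw Cw; rewrite (asboolF Dz); apply/asboolP.
exact/asboolP.
Qed.


(** Suspension coordinates normalised by the return time: the fibre is [[0, 1]] over every [y], so
    [X] becomes a quotient of the compact product of [C] and [[0, 1]]. *)
Definition box (y : X) (u : R) : X := act (u * r y) y.

Definition coord (x : X) : X * R :=
  xget (xb, 0) [set q | [/\ C q.1, 0 <= q.2 < 1 & x = box q.1 q.2]].

Lemma box_uniq y z (u v : R) : C y -> C z -> 0 <= u < 1 -> 0 <= v < 1 ->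
  box y u = box z v -> y = z /\ u = v.
Proof.
move=> Cy Cz u01 v01; have ry := sec_rpos Cy; have rz := sec_rpos Cz.
move=> /(sec_uniq Cy Cz) [||<- /mulIf]; [nra|nra|].
by move=> ->; rewrite ?gt_eqF.
Qed.

Lemma coordP x : [/\ C (coord x).1, 0 <= (coord x).2 < 1 &
  x = box (coord x).1 (coord x).2].
Proof.
rewrite /coord; case: xgetP => [q -> //|].
have [y [t [Cy tr0 ->]]] := tr_cover tr x.
have ry := sec_rpos Cy.
move=> /(_ (y, t / r y)) []; split=> //=.
  apply/andP; split; first by apply: divr_ge0; lra.
  by rewrite ltr_pdivrMr ?mul1r //; lra.
by rewrite /box divfK // gt_eqF.
Qed.

Lemma coord_box y (u : R) : C y -> 0 <= u < 1 -> coord (box y u) = (y, u).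
Proof.
move=> Cy u01; have [C1 u1 e] := coordP (box y u).
have [e1 e2] := box_uniq Cy C1 u01 u1 e.
by rewrite [coord _]surjective_pairing -e1 -e2.
Qed.

Lemma box0 y : box y 0 = y.
Proof. by rewrite /box mul0r act0. Qed.

Lemma box1 y : box y 1 = T y.
Proof. by rewrite /box mul1r. Qed.

Lemma box_near y u N : C y -> nbhs (box y u) N ->
  \forall q \near (y, u), C q.1 -> N (box q.1 q.2).
Proof.
move=> Cy /act_near [e [e0 [A nA h]]].
have ry := sec_rpos Cy.
(* [M] bounds [|u|] and the nearby return times, so the two terms of the time error below add up to
   less than [dl * (M + M)]. *)
pose M := r y + `|u| + 2.
have M0 : 0 < M by rewrite /M; have := normr_ge0 u; lra.
pose dl := Num.min 1 (e / (M + M)).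
have eM : 0 < e / (M + M) by apply: divr_gt0 => //; lra.
have dl0 : 0 < dl by rewrite lt_min ltr01.
have dl1 : dl <= 1 by rewrite ge_min lexx.
have MM : 0 < M + M by lra.
have dle : dl * (M + M) <= e by rewrite -(ler_pdivlMr _ _ MM) ge_min lexx orbT.
exists ([set z | A z /\ (C z -> `|r z - r y| < dl)], [set v | `|u - v| < dl]).
  split=> /=; last by apply/nbhs_ballP; exists dl.
  exact: filterI nA (tr_cont tr Cy dl0).
move=> [z v] /= [[Az rz] uv] Cz; apply: h Az.
have {}rz := rz Cz.
have -> : u * r y - v * r z = (u - v) * r z + u * (r y - r z) by ring.
apply: le_lt_trans (ler_normD _ _) _; rewrite !normrM.
have rzM : `|r z| <= M.
  have -> : r z = r y + (r z - r y) by ring.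
  apply: le_trans (ler_normD _ _) _; rewrite (gtr0_norm ry) /M.
  by have := normr_ge0 u; lra.
have uM : `|u| < M by rewrite /M; lra.
rewrite (distrC (r y)).
have h1 : `|u - v| * `|r z| <= dl * M by apply: ler_pM => //; exact: ltW.
have h2 : `|u| * `|r z - r y| < M * dl.
  by apply: ltr_pM.
by lra.
Qed.

(** * The projection onto a wedge given by one system of towers *)

Section LevelProjection.
Variable l : level X.
Hypothesis l_ok : level_ok C T xb l.
Let d := lv_d l.
Let k := lv_k l.
Let b := lv_b l.
Let j := lv_j l.
Let L := lv_L l.

Let tw : tower C T d k b j L.
Proof. by have [] := l_ok. Qed.

Definition level_proj (x : X) : R * R :=
  E (b (coord x).1) (((j (coord x).1)%:R + (coord x).2) / (L (coord x).1)%:R).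

Lemma level_L_gt0 y : C y -> (0 : R) < (L y)%:R.
Proof. by move=> Cy; rewrite ltr0n; have := tower_height tw Cy; case: (L y). Qed.

Lemma level_frac y (u : R) : C y -> 0 <= u < 1 -> 0 <= ((j y)%:R + u) / (L y)%:R < 1.
Proof.
move=> Cy u01; have L0 := level_L_gt0 Cy.
have : ((j y).+1%:R : R) <= (L y)%:R by rewrite ler_nat (tower_height tw).
rewrite -natr1 => jL; have j0 : (0 : R) <= (j y)%:R by rewrite ler0n.
apply/andP; split; first by apply: divr_ge0; lra.
by rewrite ltr_pdivrMr ?mul1r //; lra.
Qed.

Lemma level_proj_base x : C x -> d x -> level_proj x = wpt R.
Proof.
move=> Cx dx; rewrite /level_proj -{1 2 3 4}(box0 x) coord_box //=; last by lra.
by move: dx; rewrite -(tower_floor0 tw) // => /eqP ->; rewrite addr0 mul0r E0.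
Qed.

(** The point is the closed end [u = 1]: it belongs to the next floor, or to a base after the top
    floor, and the formula still holds there. Continuity and the left-hand pieces of [opli] rest on
    this. *)
Lemma level_proj_box y (u : R) : C y -> 0 <= u <= 1 ->
  level_proj (box y u) = E (b y) (((j y)%:R + u) / (L y)%:R).
Proof.
move=> Cy u01; have [u1|u1] := ltP u 1.
  by rewrite /level_proj coord_box //; lra.
have -> : u = 1 by lra.
rewrite box1; have CT := tr_ret tr Cy; have [dT|dT] := boolP (d (T y)).
  rewrite level_proj_base // natr1 (tower_top tw) // divff ?E1 //.
  by rewrite gt_eqF ?level_L_gt0.
rewrite /level_proj -{1 2 3 4}(box0 (T y)) coord_box //=; last by lra.
by have [-> -> ->] := tower_up tw Cy dT; rewrite addr0 natr1.
Qed.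

Lemma level_proj_tower y i (u : R) : C y -> d y -> (i < L y)%N -> 0 <= u <= 1 ->
  level_proj (box (iter i T y) u) = E (b y) ((i%:R + u) / (L y)%:R).
Proof.
move=> Cy dy iL u01; have Ci : C (iter i T y).
  by apply: (T_iter (C := C)) Cy => z; exact: tr_ret tr z.
rewrite level_proj_box //.
by have [|-> -> -> _] := tower_orbit _ tw Cy dy iL; first exact: tr_ret tr.
Qed.

Lemma level_proj_continuous : continuous level_proj.
Proof.
move=> x N nN.
pose K := C `*` `[0, 1]%classic : set (X * R).
have cK : compact K by apply: compact_setX; [exact: sec_compact|exact: segment_compact].
have onto x' : ((fun q : X * R => box q.1 q.2) @` K) x'.
  have [C1 u1 e] := coordP x'; exists (coord x') => //.
  by split=> //=; rewrite in_itv /=; lra.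
suff h : \forall x' \near x, ((fun q : X * R => box q.1 q.2) @` K) x' -> N (level_proj x').
  by apply: filterS h => x' /(_ (onto x')).
apply: (@quotient_continuous _ X (R * R)%type K (fun q : X * R => box q.1 q.2)) => //.
  move=> [y u] N' [/= Cy u01] nN'; have := box_near Cy nN'.
  by apply: filterS => q /= h [Cq _]; apply: h.
move=> [y u] N' [/= Cy u01] nN'.
have Ec : \forall v \near u, N' (E (b y) (((j y)%:R + v) / (L y)%:R)).
  move: u01 nN'; rewrite /= in_itv /= => u01; rewrite level_proj_box //.
  suff : E (b y) (((j y)%:R + v) / (L y)%:R) @[v --> u] -->
         E (b y) (((j y)%:R + u) / (L y)%:R) by move=> h /h.
  apply: (continuous_cvg _ (@E_continuous R (b y) _)).
  by apply: cvgMr_tmp; apply: cvgD; [exact: cvg_cst|exact: cvg_id].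
exists ([set z | C z -> (b z, j z, L z) = (b y, j y, L y)],
        [set v | N' (E (b y) (((j y)%:R + v) / (L y)%:R))]).
  by split=> //=; exact: (tower_lc tw).
move=> [z v] /= [zy Nv] [/= Cz v01]; move: v01; rewrite in_itv /= => v01.
by rewrite level_proj_box //; have [-> -> ->] := zy Cz.
Qed.

Lemma level_proj_range : range level_proj = Wedge k.
Proof.
apply/seteqP; split=> [_ [x _ <-]|z /WedgeP [c [s [ck s01 ->]]]].
  by apply: Wedge_E; apply: (tower_lt tw); have [] := coordP x.
have [y [Cy dy <-]] := tower_surj tw ck.
have L0 := level_L_gt0 Cy.
have sL : 0 <= s * (L y)%:R by apply: mulr_ge0; lra.
have /andP[h1 h2] := truncn_itv sL.
set i := Num.truncn _ in h1 h2.
have iL : (i < L y)%N.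
  by rewrite -(ltr_nat R); apply: le_lt_trans h1 _; rewrite gtr_pMl //; lra.
exists (box (iter i T y) (s * (L y)%:R - i%:R)) => //.
rewrite level_proj_tower //; last by rewrite -natr1 in h2; lra.
by rewrite addrC subrK mulfK // gt_eqF.
Qed.

Lemma level_proj_opli x : opli k (fun t => level_proj (act t x)) [set: R].
Proof.
have bk y : C y -> (b y < k)%N := fun Cy => tower_lt tw Cy.
apply: opli_affine => t0 _.
- by exists 1.
- have [C1 u1 e] := coordP (act t0 x).
  set y1 := (coord _).1 in C1 e; set u := (coord _).2 in u1 e.
  (* To have room on the left, a point of [C] is regarded as the end [v = 1] of the preceding
     box. *)
  have [y [v [Cy v01 {}e]]] : exists y v, [/\ C y, 0 < v <= 1 & act t0 x = box y v].
    have [u0|u0] := eqVneq u 0; last first.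
      exists y1, u; split=> //; rewrite lt_neqAle eq_sym u0; lra.
    have [y Cy Ty] := sec_T_surj C1; exists y, 1; split=> //; first by lra.
    by rewrite box1 Ty e u0 box0.
  have ry := sec_rpos Cy; have L0 := level_L_gt0 Cy.
  exists (v * r y); split; first by nra.
  exists (b y), (1 / (r y * (L y)%:R)), (((j y)%:R + v - t0 / r y) / (L y)%:R); split.
  + exact: bk.
  + by rewrite divr_gt0 // mulr_gt0.
  + move=> t ht; have -> : act t x = box y (v + (t - t0) / r y).
      rewrite /box mulrDl divfK ?gt_eqF // addrC actD -/(box y v) -e -actD.
      by rewrite subrK.
    rewrite level_proj_box //; last first.
      have : (t - t0) / r y <= 0 by rewrite ler_pdivrMr // mul0r; lra.
      have : - v <= (t - t0) / r y by rewrite ler_pdivlMr //; nra.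
      by lra.
    by congr E; field; rewrite !gt_eqF.
- have [C1 u1 e] := coordP (act t0 x).
  set y := (coord _).1 in C1 e; set v := (coord _).2 in u1 e.
  have ry := sec_rpos C1; have L0 := level_L_gt0 C1.
  exists ((1 - v) * r y); split; first by nra.
  exists (b y), (1 / (r y * (L y)%:R)), (((j y)%:R + v - t0 / r y) / (L y)%:R); split.
  + exact: bk.
  + by rewrite divr_gt0 // mulr_gt0.
  + move=> t ht; have -> : act t x = box y (v + (t - t0) / r y).
      rewrite /box mulrDl divfK ?gt_eqF // addrC actD -/(box y v) -e -actD.
      by rewrite subrK.
    rewrite level_proj_box //; last first.
      have : 0 <= (t - t0) / r y by rewrite ler_pdivlMr // mul0r; lra.
      have : (t - t0) / r y <= 1 - v by rewrite ler_pdivrMr //; lra.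
      by lra.
    by congr E; field; rewrite !gt_eqF.
Qed.

Lemma level_projection : projection act k level_proj.
Proof.
by split; [exact: level_proj_continuous|exact: level_proj_range|exact: level_proj_opli].
Qed.

End LevelProjection.


Lemma sec_iter i y : C y -> C (iter i T y).
Proof. by apply: (T_iter (C := C)) => z; exact: tr_ret tr z. Qed.

(** * Positivity and symbolic words of the bonding maps *)

Section BondingMap.
Variables (l l' : level X) (F : R * R -> R * R).
Hypothesis l_ok : level_ok C T xb l.
Hypothesis l'_ok : level_ok C T xb l'.
Hypothesis sub : forall y, C y -> lv_d l' y -> lv_d l y.
Hypothesis FP : forall x, F (level_proj l' x) = level_proj l x.

Let tw : tower C T (lv_d l) (lv_k l) (lv_b l) (lv_j l) (lv_L l).
Proof. by have [] := l_ok. Qed.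
Let tw' : tower C T (lv_d l') (lv_k l') (lv_b l') (lv_j l') (lv_L l').
Proof. by have [] := l'_ok. Qed.

(** The orbit of a base point [y] traces the circle of its tower, so [F] is read off by comparing
    both projections on floor [i]. Both ends of the arc are included to serve one-sided pieces. *)
Lemma bonding_E y i (s : R) : C y -> lv_d l' y -> (i < lv_L l' y)%N ->
  i%:R <= s * (lv_L l' y)%:R <= i.+1%:R ->
  F (E (lv_b l' y) s) = E (lv_b l (iter i T y))
    (((lv_j l (iter i T y))%:R + (s * (lv_L l' y)%:R - i%:R)) / (lv_L l (iter i T y))%:R).
Proof.
move=> Cy dy iL; rewrite -natr1 => hs; have L0 := level_L_gt0 l'_ok Cy.
have {1}-> : s = (i%:R + (s * (lv_L l' y)%:R - i%:R)) / (lv_L l' y)%:R.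
  by rewrite addrC subrK mulfK // gt_eqF.
rewrite -(level_proj_tower l'_ok) //; last by lra.
by rewrite FP (level_proj_box l_ok) //; [exact: sec_iter|lra].
Qed.

Lemma bonding_positive : positive_map (lv_k l') (lv_k l) F.
Proof.
have rg := level_proj_range l_ok; have rg' := level_proj_range l'_ok.
have [_ dx _] := l_ok; have [_ dx' _] := l'_ok; have Cxb := tr_base tr.
split.
- apply/subspace_continuousP => z Wz N nN.
  have := @quotient_continuous X _ (R * R)%type setT (level_proj l') F X_compact
    (@norm_hausdorff _ (R * R)%type) _ _ z N nN.
  rewrite rg'; apply.
    move=> y N' _ nN'; have := level_proj_continuous l'_ok nN'.
    by apply: (@filterS X) => w Nw _.
  move=> y N' _; rewrite FP => nN'; have := level_proj_continuous l_ok nN'.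
  by apply: (@filterS X) => w Nw _; rewrite FP.
- rewrite -rg -rg' image_comp.
  by have -> // : F \o level_proj l' = level_proj l by apply/funext => x; rewrite /= FP.
- by rewrite -{1}(level_proj_base l'_ok Cxb dx') FP level_proj_base.
move=> c ck; have [y [Cy dy <-]] := tower_surj tw' ck.
have L0 := level_L_gt0 l'_ok Cy.
apply: opli_affine => s /= s01.
- exists (Num.min s (1 - s) / 2); set m := Num.min _ _.
  have m0 : 0 < m by rewrite lt_min; lra.
  have m1 : m <= s by rewrite ge_min lexx.
  have m2 : m <= 1 - s by rewrite ge_min lexx orbT.
  by split; [lra|move=> t /= ht; lra].
- have sL : 0 < s * (lv_L l' y)%:R by apply: mulr_gt0; lra.
  (* For the left-hand piece, an integral value of [s * L'] must be assigned to the floor below, not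
     to the one given by truncation. *)
  have [i [iL i1 i2]] : exists i, [/\ (i < lv_L l' y)%N,
      i%:R < s * (lv_L l' y)%:R & s * (lv_L l' y)%:R <= i.+1%:R].
    have [h1 h2] := andP (truncn_itv (ltW sL)); set n := Num.truncn _ in h1 h2.
    have nL : (n < lv_L l' y)%N.
      by rewrite -(ltr_nat R); apply: le_lt_trans h1 _; rewrite gtr_pMl //; lra.
    have [e|ne] := eqVneq (s * (lv_L l' y)%:R) n%:R; last first.
      by exists n; split=> //; [rewrite lt_neqAle eq_sym ne|exact: ltW].
    case: n {h1 h2} nL e => [|n] nL e; first by rewrite e ltxx in sL.
    by exists n; rewrite e ltr_nat; split=> //; lia.
  have Ci := sec_iter i Cy; have Li := level_L_gt0 l_ok Ci.
  exists (s - i%:R / (lv_L l' y)%:R); split.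
    by rewrite subr_gt0 ltr_pdivrMr.
  exists (lv_b l (iter i T y)), ((lv_L l' y)%:R / (lv_L l (iter i T y))%:R),
    (((lv_j l (iter i T y))%:R - i%:R) / (lv_L l (iter i T y))%:R); split.
  + exact: (tower_lt tw).
  + exact: divr_gt0.
  + move=> t ht; rewrite (@bonding_E _ i) //; last first.
      apply/andP; split; last by apply: le_trans i2; rewrite ler_pM2r //; lra.
      by rewrite -ler_pdivrMr //; lra.
    by congr E; field; rewrite gt_eqF.
- have sL : 0 < s * (lv_L l' y)%:R by apply: mulr_gt0; lra.
  have [h1 h2] := andP (truncn_itv (ltW sL)); set i := Num.truncn _ in h1 h2.
  have iL : (i < lv_L l' y)%N.
    by rewrite -(ltr_nat R); apply: le_lt_trans h1 _; rewrite gtr_pMl //; lra.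
  have Ci := sec_iter i Cy; have Li := level_L_gt0 l_ok Ci.
  exists (i.+1%:R / (lv_L l' y)%:R - s); split.
    by rewrite subr_gt0 ltr_pdivlMr.
  exists (lv_b l (iter i T y)), ((lv_L l' y)%:R / (lv_L l (iter i T y))%:R),
    (((lv_j l (iter i T y))%:R - i%:R) / (lv_L l (iter i T y))%:R); split.
  + exact: (tower_lt tw).
  + exact: divr_gt0.
  + move=> t ht; rewrite (@bonding_E _ i) //; last first.
      apply/andP; split; first by apply: le_trans h1 _; rewrite ler_pM2r //; lra.
      by rewrite -ler_pdivlMr //; lra.
    by congr E; field; rewrite gt_eqF.
Qed.

(** The floors of the [l']-column at which a new [l]-tower is entered, one for each letter of the
    word. *)
Definition visits y := [seq i <- iota 0 (lv_L l' y) | lv_d l (iter i T y)].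

Lemma visits_mem y i : i \in visits y = (i < lv_L l' y)%N && lv_d l (iter i T y).
Proof. by rewrite mem_filter mem_iota andbC. Qed.

Lemma visits_head y : C y -> lv_d l' y -> exists s, visits y = 0%N :: s.
Proof.
move=> Cy dy; have := tower_height tw' Cy; rewrite /visits.
by case: (lv_L l' y) => // n _ /=; rewrite sub //; eexists.
Qed.

(** The wedge point is reached exactly at the visits, and between two consecutive visits the orbit
    climbs one [l]-tower, whose label is the letter. *)
Lemma bonding_symb y : C y -> lv_d l' y ->
  symb F (lv_b l' y) [seq lv_b l (iter i T y) | i <- visits y].
Proof.
move=> Cy dy; have L0 := level_L_gt0 l'_ok Cy.
set L' := lv_L l' y in L0 *; set v := visits y.
have vs : sorted ltn v by rewrite sorted_filter ?iota_ltn_sorted//; exact: ltn_trans.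
have vL m : (m < size v)%N -> (nth L' v m < L')%N /\ lv_d l (iter (nth L' v m) T y).
  by move=> ms; have := mem_nth L' ms; rewrite visits_mem => /andP[].
have vlt m : (m < size v)%N -> (nth L' v m < nth L' v m.+1)%N.
  move=> ms; have [ms1|ms1] := ltnP m.+1 (size v); last first.
    by rewrite (nth_default _ ms1); have [] := vL _ ms.
  exact: (sorted_ltn_nth ltn_trans).
(* The default [L'] of [nth] makes the subdivision point after the last visit equal to 1. *)
exists (fun m => (nth L' v m)%:R / L'%:R); rewrite size_map; split.
- by have [s] := visits_head Cy dy; rewrite -/v => -> /=; rewrite mul0r.
- by rewrite nth_default // divff // gt_eqF.
- by move=> m ms; rewrite ltr_pM2r ?invr_gt0 // ltr_nat vlt.
- move=> m; rewrite leq_eqVlt => /orP[/eqP ->|ms].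
    rewrite nth_default // divff ?gt_eqF // E1.
    by have [_ _ + _] := bonding_positive.
  have [mL dm] := vL _ ms; set i := nth L' v m in mL dm *.
  have Ci := sec_iter i Cy.
  rewrite (@bonding_E _ i) // ?divfK ?gt_eqF // -/L' ?divfK ?gt_eqF //; last first.
    by rewrite lexx ler_nat leqnSn.
  move: dm; rewrite -(tower_floor0 tw Ci) => /eqP ->.
  by rewrite subrr addr0 mul0r E0.
move=> m ms s /andP[s1 s2].
have sL : 0 <= s * L'%:R.
  apply: mulr_ge0; last exact: ltW.
  by apply: le_trans (ltW s1); rewrite divr_ge0 // ltW.
have [h1 h2] := andP (truncn_itv sL); set i := Num.truncn _ in h1 h2.
rewrite ltr_pdivrMr // in s1; rewrite ltr_pdivlMr // in s2.
have mi : (nth L' v m <= i)%N.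
  by rewrite -ltnS -(ltr_nat R); apply: lt_trans h2.
have im : (i < nth L' v m.+1)%N.
  by rewrite -(ltr_nat R); apply: le_lt_trans s2.
have iL : (i < L')%N.
  apply: leq_trans im _; have [ms1|ms1] := ltnP m.+1 (size v).
    by apply: ltnW; have [] := vL _ ms1.
  by rewrite nth_default.
have [mL dm] := vL _ ms.
have nd i' : (nth L' v m < i' < nth L' v m.+1)%N -> ~~ lv_d l (iter i' T y).
  move=> /andP[mi' im']; apply/negP => di'.
  have : i' \in v.
    rewrite visits_mem di' andbT; apply: leq_trans im' _.
    have [ms1|ms1] := ltnP m.+1 (size v); last by rewrite nth_default.
    by apply: ltnW; have [] := vL _ ms1.
  move=> /(nthP L') [q qs e]; rewrite -e in mi' im'.
  have lt a c : (a < size v)%N -> (c < size v)%N -> (nth L' v a < nth L' v c)%N = (a < c)%N.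
    move=> av cv; case: (ltngtP a c) => ac; last by rewrite ac ltnn.
      by rewrite (sorted_ltn_nth ltn_trans L' vs _ _ _ _ ac).
    by apply/negbTE; rewrite -leqNgt ltnW // (sorted_ltn_nth ltn_trans L' vs _ _ _ _ ac).
  rewrite lt // in mi'; have [ms1|ms1] := ltnP m.+1 (size v); last first.
    by have := leq_trans qs ms1; rewrite ltnS leqNgt mi'.
  by rewrite lt // ltnS leqNgt mi' in im'.
have bi : lv_b l (iter i T y) = lv_b l (iter (nth L' v m) T y).
  rewrite -(subnK mi) in im *; elim: (i - _)%N im => // q IH im.
  have {}IH := IH (ltnW im).
  rewrite addSn iterS -IH; have [] // := tower_up tw (sec_iter (q + nth L' v m) Cy).
  by rewrite -iterS -addSn; apply: nd; rewrite im andbT addSn ltnS leq_addl.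
have Ci := sec_iter i Cy; have ji := tower_height tw Ci.
rewrite (@bonding_E _ i) // -?/L' ?h1 ?ltW //.
rewrite (nth_map L') // -bi; split; last by eexists.
have u01 : 0 <= s * L'%:R - i%:R < 1 by rewrite -natr1 in h2; lra.
(* Being at the wedge point forces floor 0 and fraction 0: then [i] is a visit, and either it is
   visit [m] itself, which [s1] excludes, or it contradicts [nd]. *)
move=> /E_wpt => /(_ (level_frac l_ok Ci u01)) /eqP.
rewrite mulf_eq0 invr_eq0 (gt_eqF (level_L_gt0 l_ok Ci)) orbF.
have j0 : (0 : R) <= (lv_j l (iter i T y))%:R by [].
rewrite paddr_eq0 //; last by lra.
rewrite pnatr_eq0 (tower_floor0 tw Ci) => /andP[di /eqP si].
move: mi; rewrite leq_eqVlt => /orP[/eqP e|mi]; first by rewrite e in s1; lra.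
by have := nd i; rewrite mi im di => /(_ isT).
Qed.

(** After the last visit the [l]-tower no longer changes, so the last letter can be read on the top
    floor of the column, the floor to which [ref_last] applies. *)
Lemma bonding_last y : C y -> lv_d l' y ->
  last 0%N [seq lv_b l (iter i T y) | i <- visits y] = lv_b l (iter (lv_L l' y).-1 T y).
Proof.
move=> Cy dy; have [s vs] := visits_head Cy dy; rewrite vs.
rewrite [LHS](last_map (fun i => lv_b l (iter i T y)) s 0%N).
set i1 := last 0%N s.
have i1v : i1 \in visits y by rewrite vs mem_last.
have vsort : sorted leq (visits y).
  by rewrite sorted_filter ?iota_sorted//; exact: leq_trans.
have vle i : i \in visits y -> (i <= i1)%N.
  move=> /(nthP 0%N) [q qv <-]; rewrite /i1 -[last _ _]/(last 0%N (0%N :: s)) -nth_last -vs.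
  have v0 : (0 < size (visits y))%N by apply: leq_ltn_trans qv.
  have qv' : (q <= (size (visits y)).-1)%N by rewrite -ltnS prednK.
  apply: (sorted_leq_nth leq_trans leqnn 0%N vsort) => //.
  by rewrite inE prednK.
move: i1v; rewrite visits_mem => /andP[i1L di1].
have h q : (i1 + q < lv_L l' y)%N -> lv_b l (iter (i1 + q) T y) = lv_b l (iter i1 T y).
  elim: q => [|q IH] qL; first by rewrite addn0.
  rewrite addnS in qL *; rewrite -IH ?(ltnW qL) // iterS.
  have [] // := tower_up tw (sec_iter (i1 + q) Cy).
  apply/negP => dS; have /vle : (i1 + q).+1 \in visits y by rewrite visits_mem qL.
  by rewrite -addnS -[X in (_ <= X)%N]addn0 leq_add2l.
rewrite -(h ((lv_L l' y).-1 - i1)%N); last by lia.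
by congr (lv_b l (iter _ T y)); lia.
Qed.

End BondingMap.


(** Off the wedge point the circle parameter recovers the tower, the floor and the fraction, and
    [ref_code] descends to [l]. At the wedge point only membership in the base remains, which is why
    the base conditions are imposed. *)
Lemma refines_proj_eq g l l' x x' :
  level_ok C T xb l -> level_ok C T xb l' -> refines C T xb g l l' ->
  level_proj l' x = level_proj l' x' ->
  [/\ level_proj l x = level_proj l x', (coord x).2 = (coord x').2 &
      g (coord x).1 = g (coord x').1].
Proof.
move=> l_ok l'_ok ref; have [_ _ tw'] := l'_ok.
have [Cy u01 _] := coordP x; have [Cz v01 _] := coordP x'.
rewrite /level_proj; set y := (coord x).1 in Cy *; set u := (coord x).2 in u01 *.
set z := (coord x').1 in Cz *; set v := (coord x').2 in v01 *.
have s01 := level_frac l'_ok Cy u01; have t01 := level_frac l'_ok Cz v01.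
have Ly := level_L_gt0 l'_ok Cy; have Lz := level_L_gt0 l'_ok Cz.
set s := _ / _ in s01 *; set t := (_ + v) / (lv_L l' z)%:R in t01 *.
have zero w a : C w -> 0 <= a -> ((lv_j l' w)%:R + a) / (lv_L l' w)%:R = 0 :> R ->
    a = 0 /\ lv_d l' w.
  move=> Cw a0 /eqP; rewrite mulf_eq0 invr_eq0 (gt_eqF (level_L_gt0 l'_ok Cw)) orbF.
  by rewrite paddr_eq0 // pnatr_eq0 (tower_floor0 tw' Cw) => /andP[dw /eqP].
have base w : C w -> lv_d l' w ->
    E (lv_b l w) (((lv_j l w)%:R + 0) / (lv_L l w)%:R) = wpt R /\ g w = g xb.
  move=> Cw dw; split; last exact: ref_base ref _ Cw dw.
  have [_ _ tw] := l_ok; have := ref_sub ref Cw dw.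
  by rewrite -(tower_floor0 tw Cw) => /eqP ->; rewrite addr0 mul0r E0.
have [s0|s0] := eqVneq s 0.
  move=> e; have t0 : t = 0 by apply: (@E_wpt R (lv_b l' z)) => //; rewrite -e s0 E0.
  have [|u0 dy] := zero _ _ Cy _ s0; first by lra.
  have [|v0 dz] := zero _ _ Cz _ t0; first by lra.
  rewrite u0 v0; have [-> ->] := base _ Cy dy.
  by have [-> ->] := base _ Cz dz.
move=> e; have t0 : t != 0.
  apply/eqP => t0; move/eqP: s0; apply; apply: (@E_wpt R (lv_b l' y)) => //.
  by rewrite e t0 E0.
have [||bb st] := E_inj _ _ e.
- by move: s01; rewrite le_eqVlt eq_sym (negbTE s0).
- by move: t01; rewrite le_eqVlt eq_sym (negbTE t0).
have LL := tower_label tw' Cy Cz bb.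
move: st; rewrite /s /t LL => /mulIf; rewrite invr_eq0 gt_eqF // => /(_ isT) juv.
(* Equal sums of an integer and a fraction in [[0, 1)] have equal integral parts. *)
have jj : lv_j l' y = lv_j l' z.
  have lt a c (q w : R) : 0 <= q -> w < 1 -> a%:R + q = c%:R + w -> (a <= c)%N.
    move=> q0 w1 ee; rewrite -ltnS -(ltr_nat R) -natr1; lra.
  by apply/eqP; rewrite eqn_leq (lt _ _ _ _ _ _ juv) ?(lt _ _ _ _ _ _ (esym juv)) //; lra.
have uv : u = v by move: juv; rewrite jj => /addrI.
have [b1 j1 g1] := ref_code ref Cy Cz bb jj.
have [_ _ tw] := l_ok.
by split=> //; rewrite b1 j1 uv (tower_label tw Cy Cz b1).
Qed.

(** * The inverse limit and the two kinds of bonding words *)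

Section LevelExpansion.
Variables (g : nat -> X -> nat) (l : nat -> level X).
Hypothesis g_sep : forall y z, C y -> C z -> (forall n, g n y = g n z) -> y = z.
Hypothesis l_ok : forall n, level_ok C T xb (l n).
Hypothesis l_ref : forall n, refines C T xb (g n) (l n) (l n.+1).

Let p n := level_proj (l n).
(** Any preimage may be chosen, since [refines_proj_eq] makes [p n] constant on the fibres of
    [p n.+1]; the default [xb] is used off the wedge only. *)
Let f n (z : R * R) : R * R := p n (xget xb [set x | p n.+1 x = z]).

Lemma bond_proj n x : f n (p n.+1 x) = p n x.
Proof.
rewrite /f; case: xgetP => [x' -> /= e|/(_ x)]; last by case.
by have [] := refines_proj_eq (l_ok n) (l_ok n.+1) (l_ref n) e.
Qed.

Lemma fcomp_proj n m x : fcomp f n m (p (n + m)%N x) = p n x.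
Proof.
elim: m x => [|m IH] x; first by rewrite addn0.
by rewrite addnS /= bond_proj IH.
Qed.

Lemma base_sub n y : C y -> lv_d (l n) y -> lv_d (l 0%N) y.
Proof. by move=> Cy; elim: n => // n IH dy; apply: IH; exact: ref_sub (l_ref n) _ Cy dy. Qed.

Lemma level_expansion : expansion act xb (fun n => lv_k (l n)) f p.
Proof.
have Cxb := tr_base tr.
have dx n : lv_d (l n) xb by have [] := l_ok n.
split.
- by move=> i; exact: bonding_positive (l_ok i) (l_ok i.+1) (@bond_proj i).
- by move=> i; exact: level_projection.
- by move=> i; exact: level_proj_base.
- by move=> n m nm x; rewrite -(@fcomp_proj n (m - n)) subnKC // ltnW.
set phi := fun x i => p i x.
have cphi : continuous (phi : X -> {ptws nat -> (R * R)%type}).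
  move=> x; apply/pointwise_cvgP => i.
  exact: (level_proj_continuous (l_ok i)).
have iphi : injective phi.
  move=> x x' e; have pe n : p n x = p n x' by exact: (congr1 (fun h => h n) e).
  have h n := refines_proj_eq (l_ok n) (l_ok n.+1) (l_ref n) (pe n.+1).
  have [C1 _ ->] := coordP x; have [C2 _ ->] := coordP x'.
  have -> : (coord x).1 = (coord x').1 by apply: g_sep => // n; have [] := h n.
  by have [_ -> _] := h 0%N.
have rphi : range phi = invlim (fun n => lv_k (l n)) f.
  apply/seteqP; split=> [_ [x _ <-] i|w wlim].
    by split; [rewrite -(level_proj_range (l_ok i)); exists x|exact: bond_proj].
  have ex n : exists x, p n x = w n.
    have [+ _] := wlim n; rewrite -(level_proj_range (l_ok n)) => -[x _ <-].
    by exists x.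
  have [xs xsP] := choice ex.
  have dn n m : (n <= m)%N -> forall x, p m x = w m -> p n x = w n.
    elim: m => [|m IH]; first by rewrite leqn0 => /eqP ->.
    rewrite leq_eqVlt => /orP[/eqP -> //|nm] x px; apply: IH => //.
    by rewrite -bond_proj px; have [] := wlim m.
  (* The [xs m] with [m >= n] all lie over [w n], so a cluster point of the sequence lies over every
     coordinate of [w]. *)
  have [x [_ clx]] := X_compact (F := xs @ \oo) _ (@filterT _ _ _).
  exists x => //; apply/funext => n; apply: contrapT => ne.
  have [A [B [nA nB AB]]] := hausdorff_sep (@norm_hausdorff _ (R * R)%type) ne.
  have [|_ [[m /= nm <-] Am]] := clx [set xs m | m in [set m | (n <= m)%N]] (p n @^-1` A) _
     (level_proj_continuous (l_ok n) nA).
    by exists n => // m nm; exists m.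
  apply: (AB _ Am); rewrite (dn _ _ nm _ (xsP m)); exact: nbhs_singleton.
split=> // A oA; exists (~` (phi @` (~` A))); split.
  apply: closed_openC; apply: compact_closed.
    by apply: hausdorff_product => _; exact: norm_hausdorff.
  apply: continuous_compact; first exact: continuous_subspaceT.
  by apply: subclosed_compact X_compact _ => //; exact: open_closedC.
rewrite -rphi; apply/seteqP; split=> [_ [x Ax <-]|z [h [x _ e]]].
  by split; [case=> x' nA /iphi e; rewrite e in nA|exists x].
by exists x => //; apply: contrapT => nA; apply: h; exists x.
Qed.

Lemma iter_T_neq_base : aperiodic act -> forall i, (0 < i)%N -> iter i T xb <> xb.
Proof.
move=> ap i i0.
have h : forall i y, C y -> exists t, [/\ 0 <= t, (0 < i)%N -> 0 < t & iter i T y = act t y].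
  elim=> [|{i0}i IH] z Cz; first by exists 0; rewrite act0.
  have [t [t0 _ e]] := IH _ (tr_ret tr Cz); have rz := sec_rpos Cz.
  by exists (t + r z); rewrite iterSr e actD; split=> // [|_]; lra.
have [t [_ /(_ i0) t0 ->]] := h i _ (tr_base tr).
by apply: ap; rewrite gt_eqF.
Qed.

Lemma level_proper : aperiodic act ->
  forall n, proper_map (lv_k (l n.+1)) (f n).
Proof.
move=> /iter_T_neq_base ap n; have [_ dx tw] := l_ok n; have [_ dx' tw'] := l_ok n.+1.
exists (lv_b (l n) xb), (lv_b (l n) (Tinv C T xb)) => c ck.
have [y [Cy dy <-]] := tower_surj tw' ck.
have sub := ref_sub (l_ref n).
have sy := bonding_symb (l_ok n) (l_ok n.+1) sub (@bond_proj n) Cy dy.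
have lst := bonding_last (l_ok n) (l_ok n.+1) sub Cy dy.
have retl := tower_return (fun z => @tr_ret _ _ _ _ _ _ _ tr z) tw.
have retl' := tower_return (fun z => @tr_ret _ _ _ _ _ _ _ tr z) tw'.
have L0 := tower_height tw Cy; have L0' := tower_height tw' Cy.
(* The finer column is strictly longer than the coarse tower at its bottom: [ref_proper] excludes
   equality, and a shorter column would return to the coarse base too early. Floor [lv_L (l n) y] is
   thus a second visit, and the word has two or more letters. *)
have LL : (lv_L (l n) y < lv_L (l n.+1) y)%N.
  have /negP nd := ref_proper (l_ref n) ap Cy dy.
  have dr := retl' _ Cy dy.
  rewrite ltn_neqAle; apply/andP; split; first by apply/eqP => e; apply: nd; rewrite e.
  rewrite leqNgt; apply/negP => lt.
  have [_ _ _] := tower_orbit (fun z => @tr_ret _ _ _ _ _ _ _ tr z) tw Cy (sub _ Cy dy) lt.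
  have L'0 : (0 < lv_L (l n.+1) y)%N by lia.
  by move=> /(_ L'0) /negP; apply; apply: sub => //; exact: sec_iter.
have [s vs] := visits_head (l_ok n.+1) sub Cy dy; move: sy lst; rewrite vs /=.
have : lv_L (l n) y \in visits (l n) (l n.+1) y.
  by rewrite visits_mem LL retl ?sub.
rewrite vs inE => /orP[/eqP e|]; first by lia.
case/lastP: s {vs} => // s i1 _.
rewrite map_rcons last_rcons => sy lst.
have <- : lv_b (l n) (iter i1 T y) = lv_b (l n) (Tinv C T xb).
  rewrite lst (ref_last (l_ref n)) //; first exact: sec_iter.
  by rewrite -iterS prednK ?retl' //; lia.
by rewrite -(ref_first (l_ref n) Cy dy); eexists; exact: sy.
Qed.

(* Visits of [xb] to the base of level 0 stay at [xb], so at every level the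
   tower through [xb] is traversed exactly once, as a single letter. *)
Lemma level_degenerate_proper :
  (forall i, lv_d (l 0%N) (iter i T xb) -> iter i T xb = xb) ->
  forall n, (0 < n)%N -> degenerate_proper (lv_k (l n)) (fcomp f 0 n).
Proof.
move=> per n n0; have [_ dx0 tw0] := l_ok 0%N; have [_ dx tw] := l_ok n.
have Cxb := tr_base tr.
have TC := fun z => @tr_ret _ _ _ _ _ _ _ tr z.
have sub y : C y -> lv_d (l n) y -> lv_d (l 0%N) y by exact: base_sub.
have sub1 y : C y -> lv_d (l n) y -> lv_d (l 1%N) y.
  move=> Cy; case: n n0 {dx tw sub} => // n _; elim: n => // n IH dy.
  by apply: IH; exact: ref_sub (l_ref n.+1) _ Cy dy.
have FP x : fcomp f 0 n (p n x) = p 0%N x by exact: fcomp_proj.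
have L0 := tower_height tw0 Cxb.
(* By [per] the level 0 column of [xb] ends at [xb], which is in the base of level 1, so [ref_last]
   applies to its top floor. *)
have last0 : lv_b (l 0%N) (Tinv C T xb) = lv_b (l 0%N) xb.
  have iL : ((lv_L (l 0%N) xb).-1 < lv_L (l 0%N) xb)%N by lia.
  have [_ <- _ _] := tower_orbit TC tw0 Cxb dx0 iL.
  apply/esym/(ref_last (l_ref 0%N)); first exact: sec_iter.
  rewrite -iterS prednK; last by lia.
  by rewrite per ?(tower_return TC tw0) //; have [] := l_ok 1%N.
exists (lv_b (l 0%N) xb); split.
  move=> c ck; have [y [Cy dy <-]] := tower_surj tw ck.
  have sy := bonding_symb (l_ok 0%N) (l_ok n) sub FP Cy dy.
  have lst := bonding_last (l_ok 0%N) (l_ok n) sub Cy dy.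
  exists [seq lv_b (l 0%N) (iter i T y) | i <- visits (l 0%N) (l n) y].
  have Ly := tower_height tw Cy.
  split=> //; split; last split.
  - by have [s ->] := visits_head (l_ok n) sub Cy dy.
  - have [s -> /=] := visits_head (l_ok n) sub Cy dy.
    exact: ref_first (l_ref 0%N) _ Cy (sub1 _ Cy dy).
  - rewrite lst (ref_last (l_ref 0%N)) //; first exact: sec_iter.
    rewrite -iterS prednK; last by lia.
    by apply: sub1; [exact: sec_iter|exact: (tower_return TC tw Cy dy)].
exists (lv_b (l n) xb); split; first exact: (tower_lt tw Cxb).
have := bonding_symb (l_ok 0%N) (l_ok n) sub FP Cxb dx.
(* A visit at [i > 0] would be [xb] itself, hence a return to the base of level [n] before the
   column ends. *)
suff -> : visits (l 0%N) (l n) xb = [:: 0%N] by [].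
have [s vs] := visits_head (l_ok n) sub Cxb dx; rewrite vs.
case: s vs => // i s vs.
have : sorted ltn (visits (l 0%N) (l n) xb).
  by rewrite sorted_filter ?iota_ltn_sorted//; exact: ltn_trans.
rewrite vs /= => /andP[i0 _].
have : i \in visits (l 0%N) (l n) xb by rewrite vs !inE eqxx orbT.
rewrite visits_mem => /andP[iL /per e].
by have [_ _ _ /(_ i0)] := tower_orbit TC tw Cxb dx iL; rewrite e dx.
Qed.

End LevelExpansion.

(** At scale [1 / n.+1] a finite clopen cover is chosen, and a point is labelled by the first member
    containing it; points with equal labels share a member. *)
Lemma separating_labels (dist : X -> X -> R) :
  (forall x y, dist x y = 0 -> x = y) -> (forall x y, 0 <= dist x y) ->
  (forall x y, dist x y = dist y x) ->
  (forall x y z, dist x z <= dist x y + dist y z) ->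
  (forall x (e : R), 0 < e -> nbhs x [set y | dist x y < e]) ->
  exists g : nat -> X -> nat, (forall n, loc_const C (g n)) /\
    forall y z, C y -> C z -> (forall n, g n y = g n z) -> y = z.
Proof.
move=> d0 dge dsym dtri dball.
have one n : exists g : X -> nat, loc_const C g /\
    forall y z, C y -> C z -> g y = g z -> dist y z < 2 / n.+1%:R.
  have e0 : 0 < 1 / n.+1%:R :> R by rewrite divr_gt0.
  have ex y : exists D : X -> bool, C y -> [/\ loc_const C D, D y &
      forall z, C z -> D z -> dist y z < 1 / n.+1%:R].
    have [Cy|nC] := pselect (C y); last by exists xpredT.
    by have [D [h1 h2 h3]] := sec_zd Cy (dball y _ e0); exists D.
  have [D DP] := choice ex.
  have [s [sC sP]] : exists s : seq X, (forall y, List.In y s -> C y) /\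
      forall x, C x -> exists y, List.In y s /\ (C x -> D y x).
    apply: (compact_finite_cover (V := fun y => [set x | C x -> D y x])); first exact: sec_compact.
    by move=> y Cy; have [lD Dy _] := DP _ Cy; apply: filterS (lD _ Cy) => z h Cz; rewrite h.
  exists (fun z => find (fun y => D y z) s); split.
    move=> y Cy; elim: s sC {sP} => [|a s IH] sC /=; first by apply: filterS (@filterT _ (nbhs y) _).
    have [lD _ _] := DP a (sC a (or_introl erefl)).
    apply: filterS2 (lD _ Cy) (IH (fun b h => sC b (or_intror h))) => z h1 h2 Cz.
    by rewrite h1 // h2.
  move=> y z Cy Cz e.
  have [w [Cw Dy Dz]] : exists w, [/\ C w, D w y & D w z].
    have := sP _ Cy; have := sP _ Cz; elim: s sC e {sP} => [|a s IH] sC /=.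
      by move=> _ _ [? []].
    have [Day|nDay] := boolP (D a y); have [Daz|nDaz] := boolP (D a z) => //.
      by move=> _ _ _; exists a; split=> //; apply: sC; left.
    move=> [] e [u [hu Du]] [v [hv Dv]]; apply: IH => //.
    - by move=> b hb; apply: sC; right.
    - exists u; split=> //; case: hu => // au; move: nDaz; rewrite au Du //.
    - exists v; split=> //; case: hv => // av; move: nDay; rewrite av Dv //.
  have [_ _ h] := DP _ Cw.
  have := h _ Cy Dy; have := h _ Cz Dz; have := dtri y w z; rewrite (dsym y w).
  have -> : 2 / n.+1%:R = 1 / n.+1%:R + 1 / n.+1%:R :> R by rewrite -mulrDl.
  set q : R := 1 / _; move=> h1 h2 h3; apply: le_lt_trans h1 _.
  exact: ltrD.
have [g gP] := choice one; exists g; split=> [n|y z Cy Cz e]; first by have [] := gP n.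
apply: d0; apply/eqP/negPn/negP => nz.
have dp : 0 < dist y z by rewrite lt_neqAle eq_sym nz dge.
have [_ h] := gP (Num.truncn (2 / dist y z)).
have := h _ _ Cy Cz (e _); rewrite ltNge => /negP; apply.
have d2 : 0 <= 2 / dist y z by rewrite divr_ge0 // ltW.
have /andP[_ h2] := truncn_itv d2.
rewrite ler_pdivrMr // mulrC -ler_pdivrMr //; exact: ltW.
Qed.

End FlowTransversal.

(** * Sums modulo 2 *)

Section Parity.

(** Summation by parts modulo 2: changes of [a] on the pieces marked by [s] are traded for values of
    [a] where [s] switches. *)
Lemma big_addb_abel (s a : nat -> bool) n :
  \big[addb/false]_(m < n.+1) (s m && (a m (+) a m.+1)) =
  (s 0%N && a 0%N) (+) (s n && a n.+1) (+)
  \big[addb/false]_(m < n) ((s m (+) s m.+1) && a m.+1).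
Proof.
elim: n => [|n IH]; first by rewrite big_ord_recr !big_ord0 /=; case: (s 0%N) (a 0%N) (a 1%N) => [] [] [].
rewrite big_ord_recr IH /= [in RHS]big_ord_recr /=.
by move: (\big[_/_]_(_ < n) _); case: (s 0%N) (a 0%N) (s n) (s n.+1) (a n.+1) (a n.+2) => [] [] [] [] [] [] [].
Qed.

Lemma big_addb_telescope (s : nat -> bool) n :
  \big[addb/false]_(m < n) (s m (+) s m.+1) = s 0%N (+) s n.
Proof.
elim: n => [|n IH]; first by rewrite big_ord0 addbb.
by rewrite big_ord_recr IH /=; case: (s 0%N) (s n) (s n.+1) => [] [] [].
Qed.

End Parity.

(** * Crossing parity of orbit segments *)

Section FlowSection.
Variables (R : realType) (X : topologicalType) (act : R -> X -> X).
Hypothesis X_compact : compact [set: X].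
Hypothesis act_continuous : continuous (fun q : R * X => act q.1 q.2).
Hypothesis act0 : forall x, act 0 x = x.
Hypothesis actD : forall s t x, act (s + t) x = act s (act t x).

Lemma orbit_continuous x : continuous (fun t => act t x).
Proof.
move=> t N nN; have [e [e0 [A nA h]]] := act_near act_continuous nN.
apply/nbhs_ballP; exists e => // s ts; apply: h => //; exact: nbhs_singleton.
Qed.

Lemma orbit_piece_near (h : R) x (P : set X) : 0 <= h -> open P ->
  (forall s, 0 <= s <= h -> P (act s x)) ->
  \forall x' \near x, forall s, 0 <= s <= h -> P (act s x').
Proof.
move=> h0 oP Px.
have : \forall x' \near x, forall s : R, `[0, h]%classic s -> P (act s x').
  apply: compact_near; first exact: segment_compact.
  move=> s; rewrite /= in_itv /= => sh.
  have [|e [e0 [A nA hA]]] := act_near (t := s) (x := x) (N := P) act_continuous.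
    by apply: open_nbhs_nbhs; split=> //; exact: Px.
  exists [set s' | `|s - s'| < e], A; split=> //; last by move=> s' x' _; exact: hA.
  by apply/nbhs_ballP; exists e.
by apply: filterS => x' H s sh; apply: H; rewrite /= in_itv.
Qed.

Variables (K A A' P : set X) (e : R).
Hypothesis e0 : 0 < e.
Hypothesis oA : open A.
Hypothesis oA' : open A'.
Hypothesis oP : open P.
Hypothesis cover : forall x, [\/ A x, A' x | P x].
Hypothesis triple : forall x, A x -> A' x -> P x -> False.
Hypothesis bottom : forall z, K z -> ~ P (act (- e) z).
Hypothesis topA : forall z, K z -> ~ A (act e z).
Hypothesis topA' : forall z, K z -> ~ A' (act e z).

Let M : set X := A `|` A'.
Let oM : open M.
Proof. exact: openU. Qed.

(** A Lebesgue number, in the time direction, for the open cover of [X] by [P] and [M]. *)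
Lemma uniform_step : exists n : nat, forall x,
  (forall s, 0 <= s <= 2 * e / n.+1%:R -> P (act s x)) \/
  (forall s, 0 <= s <= 2 * e / n.+1%:R -> M (act s x)).
Proof.
have : \forall n \near \oo, forall x, [set: X] x ->
    (forall s, 0 <= s <= 2 * e / n.+1%:R -> P (act s x)) \/
    (forall s, 0 <= s <= 2 * e / n.+1%:R -> M (act s x)).
  apply: compact_near => // x _.
  have key Q : open Q -> Q x -> exists B, nbhs x B /\
      exists n, forall m, (n <= m)%N -> forall x' s, B x' ->
        0 <= s <= 2 * e / m.+1%:R -> Q (act s x').
    move=> oQ Qx; have [|d [d0 [B nB hB]]] := act_near (t := 0) (x := x) (N := Q) act_continuous.
      by rewrite act0; apply: open_nbhs_nbhs.
    exists B; split=> //; exists (Num.truncn (2 * e / d)) => m nm x' s Bx' sm; apply: hB => //.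
    have ed : 0 <= 2 * e / d by rewrite divr_ge0 ?mulr_ge0 // ltW.
    have /andP[_ h2] := truncn_itv ed.
    have h3 : 2 * e / d < m.+1%:R by apply: lt_le_trans h2 _; rewrite ler_nat.
    have m0 : 0 < m.+1%:R :> R by rewrite ltr0n.
    rewrite sub0r normrN ger0_norm; last by lra.
    case/andP: sm => _ sm; apply: (le_lt_trans sm).
    by rewrite ltr_pdivrMr // (mulrC d) -ltr_pdivrMr.
  have [Px|Mx] : P x \/ M x by case: (cover x) => h; [right; left|right; right|left].
    have [B [nB [n hn]]] := key _ oP Px; exists B, [set m | (n <= m)%N]; split=> //.
      by exists n.
    by move=> x' m _ Bx' nm; left=> s; apply: hn.
  have [B [nB [n hn]]] := key _ oM Mx; exists B, [set m | (n <= m)%N]; split=> //.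
    by exists n.
  by move=> x' m _ Bx' nm; right=> s; apply: hn.
by move=> [n _ hn]; exists n => x; apply: (hn n) => /=.
Qed.

(** Inside both [P] and [M] the sets [A] and [A'] are complementary, since no point is triple, hence
    relatively clopen; a segment is connected. *)
Lemma piece_switch x h : 0 <= h ->
  (forall s, 0 <= s <= h -> P (act s x)) -> (forall s, 0 <= s <= h -> M (act s x)) ->
  (A x <-> A (act h x)).
Proof.
move=> h0 hP hM.
have AA' s : 0 <= s <= h -> A (act s x) <-> ~ A' (act s x).
  move=> sh; split=> [As A's|nA']; first exact: (triple As A's (hP _ sh)).
  by case: (hM _ sh).
have conn := @segment_connected R 0 h.
pose B := [set s : R | `[0, h]%classic s /\ A (act s x)].
have BT : B !=set0 -> B = `[0, h]%classic.
  move=> B0; apply: conn => //.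
  - exists [set s | A (act s x)] => //.
    by move/continuousP: (@orbit_continuous x); apply.
  - exists (~` [set s | A' (act s x)]).
      by apply: open_closedC; move/continuousP: (@orbit_continuous x); apply.
    by apply/seteqP; split=> s /= []; rewrite in_itv /= => sh /(AA' _ sh).
have m0 : `[0, h]%classic (0 : R) by rewrite /= in_itv /= lexx.
have mh : `[0, h]%classic (h : R) by rewrite /= in_itv /= lexx h0.
split=> [Ax|Ah].
  have : B h by rewrite BT //; exists 0; split=> //; rewrite act0.
  by case.
have : B 0 by rewrite BT //; exists h; split.
by case; rewrite act0.
Qed.

(* The parity of the number of times the orbit segment of [z] crosses from
   [A `|` A'] to [P] inside [A] is a locally constant function of [z]. *)
Lemma crossing_parity : exists kappa : X -> bool,
  [/\ loc_const K kappa,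
      forall z, K z -> (forall t, `|t| <= e -> ~ A' (act t z)) -> kappa z &
      forall z, K z -> (forall t, `|t| <= e -> ~ A (act t z)) -> ~~ kappa z].
Proof.
have [n step] := uniform_step; set h := 2 * e / n.+1%:R in step.
have n0 : 0 < n.+1%:R :> R by rewrite ltr0n.
have h0 : 0 < h by rewrite divr_gt0 // mulr_gt0.
have hn : n.+1%:R * h = 2 * e by rewrite /h mulrC divfK // gt_eqF.
pose pt m z := act (- e + m%:R * h) z.
have ptS m z : pt m.+1 z = act h (pt m z).
  by rewrite /pt -actD -natr1 mulrDl mul1r addrA [h + _]addrC.
have pt0 z : pt 0%N z = act (- e) z by rewrite /pt mul0r addr0.
have ptn z : pt n.+1 z = act e z by rewrite /pt hn; congr act; ring.
pose inP m z := forall s, 0 <= s <= h -> P (act s (pt m z)).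
pose inM m z := forall s, 0 <= s <= h -> M (act s (pt m z)).
have hh : (0 <= (0 : R) <= h) /\ (0 <= h <= h).
  by split; apply/andP; split; rewrite ?lexx // ltW.
have inP0 m z : inP m z -> P (pt m z) /\ P (pt m.+1 z).
  by move=> H; rewrite ptS; split; [rewrite -[pt m z]act0|]; apply: H; case: hh.
have inM0 m z : inM m z -> M (pt m z) /\ M (pt m.+1 z).
  by move=> H; rewrite ptS; split; [rewrite -[pt m z]act0|]; apply: H; case: hh.
pose sg m z := `[< inP m z >].
pose a m z := `[< A (pt m z) >].
have sgP m z : if sg m z then inP m z else inM m z.
  by rewrite /sg; case: asboolP => // nP; case: (step (pt m z)).
have apiece m z : inP m z -> inM m z -> a m z = a m.+1 z.
  move=> hP hM; have [i1 i2] := piece_switch (ltW h0) hP hM.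
  by rewrite /a ptS; apply/asboolP/asboolP.
have sg0 z : K z -> sg 0%N z = false.
  by move=> Kz; apply/asboolP => /inP0 []; rewrite pt0 => /(bottom Kz).
have sgn z : K z -> sg n z = true.
  move=> Kz; have := sgP n z; case: (sg n z) => // /inM0 [_].
  by rewrite ptn => -[/(topA Kz)|/(topA' Kz)].
have an z : K z -> a n.+1 z = false.
  by move=> Kz; apply/asboolP; rewrite ptn; exact: topA.
have switch m z : sg m z (+) sg m.+1 z -> P (pt m.+1 z) /\ M (pt m.+1 z).
  have := sgP m z; have := sgP m.+1 z.
  case: (sg m z); case: (sg m.+1 z) => //= h1 h2 _; split.
  - by have [] := inP0 _ _ h2.
  - by have [] := inM0 _ _ h1.
  - by have [] := inP0 _ _ h1.
  - by have [] := inM0 _ _ h2.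
(* This form does not depend on how ambiguous pieces are marked. Summation by parts turns it into a
   count of switches inside [A]; the boundary terms vanish as the segment starts outside [P] and
   ends outside [A]. *)
pose kappa z := \big[addb/false]_(m < n.+1) (sg m z && (a m z (+) a m.+1 z)).
have kappaE z : K z ->
    kappa z = \big[addb/false]_(m < n) ((sg m z (+) sg m.+1 z) && a m.+1 z).
  move=> Kz; rewrite /kappa (big_addb_abel (sg^~ z) (a^~ z)).
  by rewrite sg0 // an // andbF.
exists kappa; split; last first.
- move=> z Kz nA; rewrite kappaE // big1 // => m _.
  suff -> : a m.+1 z = false by rewrite andbF.
  apply/asboolP/nA; have mn : m.+1%:R <= n.+1%:R :> R by rewrite ler_nat ltnS ltnW.
  have : m.+1%:R * h <= n.+1%:R * h by rewrite ler_pM2r.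
  have : 0 <= m.+1%:R * h by rewrite mulr_ge0 // ltW.
  by rewrite hn ler_norml; lra.
(* Without [A'] every switch happens in [A], and their number is odd because the marking goes from
   [M] to [P]. *)
- move=> z Kz nA'; rewrite kappaE // (eq_bigr (fun m : 'I_n => sg m z (+) sg m.+1 z)).
    by rewrite (big_addb_telescope (sg^~ z)) sg0 // sgn.
  move=> m _; case E : (_ (+) _) => //=.
  have [_ []] := switch _ _ E; first by move=> Ax; apply/asboolP.
  move=> A'x; exfalso; apply: nA' A'x.
  have mn : m.+1%:R <= n.+1%:R :> R by rewrite ler_nat ltnS ltnW.
  have : m.+1%:R * h <= n.+1%:R * h by rewrite ler_pM2r.
  have : 0 <= m.+1%:R * h by rewrite mulr_ge0 // ltW.
  by rewrite hn ler_norml; lra.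
move=> z Kz.
have near_pt m N : nbhs (pt m z) N -> \forall z' \near z, N (pt m z').
  exact: act_near2.
have Q1 : \forall z' \near z, forall m : 'I_n.+1, if sg m z then inP m z' else inM m z'.
  apply: filter_forall => m; have := sgP m z; case: (sg m z) => H.
    exact: near_pt (orbit_piece_near (ltW h0) oP H).
  exact: near_pt (orbit_piece_near (ltW h0) oM H).
(* A switch lies in [P] and in exactly one of [A], [A']; being in [A], or in both [A'] and [P], is
   an open condition that decides [a]. *)
have Q2 : \forall z' \near z, forall m : 'I_n,
    (sg m z (+) sg m.+1 z) && a m.+1 z' = (sg m z (+) sg m.+1 z) && a m.+1 z.
  apply: filter_forall => m; case E : (_ (+) _); last by apply: filterS (@filterT _ (nbhs z) _).
  have [Px [Ax|A'x]] := switch _ _ E.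
    have nA : nbhs (pt m.+1 z) A by apply: open_nbhs_nbhs.
    apply: filterS (near_pt _ _ nA) => z' Az' /=.
    by rewrite /a !asboolT.
  have nA : nbhs (pt m.+1 z) (A' `&` P) by apply: open_nbhs_nbhs; split=> //; apply: openI.
  apply: filterS (near_pt _ _ nA) => z' [A'z' Pz'] /=.
  by rewrite /a !asboolF // => Az; [exact: triple Az A'x Px|exact: triple Az A'z' Pz'].
apply: filterS2 Q1 Q2 => z' H1 H2 Kz'.
(* The markings of [z] and [z'] can differ only on pieces lying in both [P] and [M], where [a] does
   not change, so the marking of [z] may be frozen. *)
have -> : kappa z' = \big[addb/false]_(m < n.+1) (sg m z && (a m z' (+) a m.+1 z')).
  apply: eq_bigr => m _; have := H1 m; case E : (sg m z) => iM.
    by rewrite /sg asboolT.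
  case E' : (sg m z') => //=; have := sgP m z'; rewrite E' => iP.
  by rewrite apiece ?addbb.
rewrite (big_addb_abel (sg^~ z) (a^~ z')) sg0 // an // andbF !addFb kappaE //.
exact: eq_bigr.
Qed.

End FlowSection.

(** * The local time coordinate *)

Section MetricFlow.
Variables (R : realType) (X : topologicalType) (act : R -> X -> X).
Hypothesis X_compact : compact [set: X].
Hypothesis act_continuous : continuous (fun q : R * X => act q.1 q.2).
Hypothesis act0 : forall x, act 0 x = x.
Hypothesis actD : forall s t x, act (s + t) x = act s (act t x).
Variable dist : X -> X -> R.
Hypothesis dist_ge0 : forall x y, 0 <= dist x y.
Hypothesis dist_eq0 : forall x y, dist x y = 0 <-> x = y.
Hypothesis dist_sym : forall x y, dist x y = dist y x.
Hypothesis dist_triangle : forall x y z, dist x z <= dist x y + dist y z.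
Hypothesis dist_open : forall A : set X, open A <->
  (forall x, A x -> exists e : R, 0 < e /\ [set y | dist x y < e] `<=` A).

Lemma dist_xx x : dist x x = 0.
Proof. exact/dist_eq0. Qed.

Lemma dist_ball x (e : R) : 0 < e -> nbhs x [set y | dist x y < e].
Proof.
move=> e0; apply: open_nbhs_nbhs; split; last by rewrite /= dist_xx.
apply/dist_open => y /= xy; exists (e - dist x y); split; first by rewrite subr_gt0.
by move=> z /= yz; have := dist_triangle x y z; lra.
Qed.

Lemma dist_nbhs x N : nbhs x N -> exists e : R, 0 < e /\ [set y | dist x y < e] `<=` N.
Proof.
rewrite nbhsE => -[A [oA Ax] AN]; have [e [e0 eA]] := (dist_open A).1 oA _ Ax.
by exists e; split=> // y /eA /AN.
Qed.

Lemma dist_hausdorff : hausdorff_space X.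
Proof.
move=> x y clxy; apply/dist_eq0/eqP/negPn/negP => xy0.
have xy : 0 < dist x y by rewrite lt_neqAle eq_sym xy0 dist_ge0.
have e0 : 0 < dist x y / 2 by rewrite divr_gt0.
have [z [/= xz yz]] := clxy _ _ (dist_ball x e0) (dist_ball y e0).
by have := dist_triangle x z y; rewrite (dist_sym z); lra.
Qed.

Lemma dist_near x y (e : R) : 0 < e -> \forall x' \near x, `|dist x' y - dist x y| < e.
Proof.
move=> e0; apply: filterS (dist_ball x e0) => x' /= xx'.
have := dist_triangle x x' y; have := dist_triangle x' x y.
by rewrite (dist_sym x' x) ltr_norml; lra.
Qed.

Section LocalTime.
Variable xb : X.

Lemma height_near (M : R) x (s e : R) : 0 < e ->
  exists dl : R, 0 < dl /\ exists2 A, nbhs x A & forall s' x', `|s - s'| < dl -> A x' ->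
    `|(- M * dist (act s' x') xb - s') - (- M * dist (act s x) xb - s)| < e.
Proof.
move=> e0; pose q := e / 2 / (`|M| + 1).
have M1 : 0 < `|M| + 1 by rewrite ltr_wpDl.
have q0 : 0 < q by rewrite !divr_gt0.
have [dl [dl0 [A nA hA]]] := act_near act_continuous (dist_near (act s x) xb q0).
exists (Num.min dl (e / 2)); split; first by rewrite lt_min dl0 divr_gt0.
exists A => // s' x'; rewrite lt_min => /andP[s1 s2] Ax'.
have := hA _ _ s1 Ax'; set D := dist _ _; set D' := dist _ _ => DD.
have -> : - M * D - s' - (- M * D' - s) = - (M * (D - D')) + (s - s') by ring.
apply: le_lt_trans (ler_normD _ _) _; rewrite normrN normrM.
have : `|M| * `|D - D'| <= (`|M| + 1) * `|D - D'| by rewrite ler_wpM2r // lerDl.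
have : (`|M| + 1) * `|D - D'| < (`|M| + 1) * q by rewrite ltr_pM2l.
have -> : (`|M| + 1) * q = e / 2 by rewrite /q mulrC divfK // gt_eqF.
lra.
Qed.

(* The time coordinate is the value of an optimal hitting problem: if
   [G x = sup_(|s| <= a) (- M * dist (act s x) xb - s)] then near [xb] the
   supremum is not approached close to the ends of [[-a, a]], so moving along
   the orbit by [t] shifts [G] by exactly [t]. *)
Lemma local_time : (exists t, act t xb <> xb) ->
  exists (tau : X -> R) (O : set X) (e : R),
    [/\ continuous tau, open O, O xb, 0 < e &
     tau xb = 0 /\
     forall x t, O x -> `|t| <= e -> tau (act t x) = tau x + t].
Proof.
move=> [t0 t0P]; pose a := `|t0|.
have tn0 : t0 != 0 by apply/eqP => t00; apply: t0P; rewrite t00 act0.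
have a0 : 0 < a by rewrite normr_gt0.
have per t : act (- t) xb = xb -> act t xb = xb.
  by move=> e; rewrite -{1}e -actD subrr act0.
have aP : act a xb <> xb.
  rewrite /a; case: (ger0P t0) => // _ e; apply: t0P; exact: per.
have aN : act (- a) xb <> xb by move/per.
have dpos x : x <> xb -> 0 < dist x xb.
  by move=> xx; rewrite lt_neqAle dist_ge0 andbT eq_sym; apply/eqP => /dist_eq0.
pose c := Num.min (dist (act a xb) xb) (dist (act (- a) xb) xb).
have c0 : 0 < c by rewrite lt_min !dpos.
have c1 : c <= dist (act a xb) xb by rewrite /c ge_min lexx.
have c2 : c <= dist (act (- a) xb) xb by rewrite /c ge_min lexx orbT.
(* With this penalty [h xb] is at most -2 at both times [a] and [- a], whereas [h xb 0 = 0]; after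
   an error of 1 nearby, the value -1 still separates them. *)
pose M := (a + 2) / c.
have M0 : 0 < M by rewrite divr_gt0 // addr_gt0.
have Mc : M * c = a + 2 by rewrite /M divfK // gt_eqF.
pose h x s := - M * dist (act s x) xb - s.
have hle x s : - a <= s -> h x s <= a.
  by move=> sa; have := mulr_ge0 (ltW M0) (dist_ge0 (act s x) xb); rewrite /h; lra.
pose S x := [set h x s | s in `[- a, a]%classic].
have Ssup x : has_sup (S x).
  split; first by exists (h x 0), 0 => //; rewrite /= in_itv /=; lra.
  by exists a => _ [s + <-]; rewrite /= in_itv /= => /andP[sa _]; exact: hle.
pose G x := sup (S x).
have Gub x s : - a <= s <= a -> h x s <= G x.
  by move=> sa; apply: sup_upper_bound => //; exists s => //; rewrite /= in_itv.
have Gle x u : (forall s, - a <= s <= a -> h x s <= u) -> G x <= u.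
  move=> H; apply: ge_sup; first by have [] := Ssup x.
  by move=> _ [s + <-]; rewrite /= in_itv /=; exact: H.
have Gcont : continuous G.
  move=> x; apply/cvgrPdist_le => e e0.
  have e2 : 0 < e / 2 by rewrite divr_gt0.
  have : \forall x' \near x, forall s : R, `[- a, a]%classic s -> `|h x' s - h x s| <= e.
    apply: compact_near; first exact: segment_compact.
    move=> s _; have [dl [dl0 [A nA hA]]] := height_near M x s e2.
    exists [set s' | `|s - s'| < dl], A; split=> //; first by apply/nbhs_ballP; exists dl.
    move=> s' x' _ ss' Ax'.
    have h1 : `|h x' s' - h x s| < e / 2 := hA _ _ ss' Ax'.
    have h2 : `|h x s' - h x s| < e / 2 := hA _ _ ss' (nbhs_singleton nA).
    by move: h1 h2; rewrite !ltr_norml ler_norml; lra.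
  apply: filterS => x' H; rewrite ler_norml.
  have H' s : - a <= s <= a -> `|h x' s - h x s| <= e.
    by move=> sa; apply: H; rewrite /= in_itv.
  have : G x <= G x' + e.
    by apply: Gle => s sa; have := H' _ sa; have := Gub x' _ sa; rewrite ler_norml; lra.
  have : G x' <= G x + e.
    by apply: Gle => s sa; have := H' _ sa; have := Gub x _ sa; rewrite ler_norml; lra.
  lra.
have ends u : act u xb <> xb -> c <= dist (act u xb) xb -> - u <= a ->
    exists dl, 0 < dl /\ exists2 A, nbhs xb A &
     forall s' x', `|u - s'| < dl -> A x' -> h x' s' < -1.
  move=> _ cu ua; have [dl [dl0 [A nA hA]]] := height_near M xb u ltr01.
  exists dl; split=> //; exists A => // s' x' us Ax'.
  have := hA _ _ us Ax'; rewrite -/(h x' s') ltr_norml.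
  have : M * c <= M * dist (act u xb) xb by rewrite ler_pM2l.
  rewrite Mc mulNr; lra.
have [dp [dp0 [Ap nAp hAp]]] : exists dl, 0 < dl /\ exists2 A, nbhs xb A &
     forall s' x', `|a - s'| < dl -> A x' -> h x' s' < -1 by apply: ends => //; lra.
have [dm [dm0 [Am nAm hAm]]] : exists dl, 0 < dl /\ exists2 A, nbhs xb A &
     forall s' x', `|- a - s'| < dl -> A x' -> h x' s' < -1 by apply: ends => //; lra.
have [dz [dz0 [Az nAz hAz]]] := height_near M xb 0 ltr01.
have hAz' x' : Az x' -> -1 < h x' 0.
  move=> Ax'; have z0 : `|0 - 0 : R| < dz by rewrite subrr normr0.
  have : `|h x' 0 - h xb 0| < 1 := hAz _ _ z0 Ax'.
  have -> : h xb 0 = 0 by rewrite /h act0 dist_xx mulr0 subrr.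
  by rewrite ltr_norml; lra.
have : nbhs xb (Ap `&` Am `&` Az) by apply: filterI => //; exact: filterI.
rewrite nbhsE => -[U [oU Ux] sU].
pose e := Num.min (Num.min dp dm) a / 2.
have mp : 0 < Num.min (Num.min dp dm) a by rewrite !lt_min dp0 dm0.
have e0 : 0 < e by rewrite divr_gt0.
have m1 : Num.min (Num.min dp dm) a <= dp by rewrite !ge_min lexx.
have m2 : Num.min (Num.min dp dm) a <= dm by rewrite !ge_min lexx orbT.
have m3 : Num.min (Num.min dp dm) a <= a by rewrite ge_min lexx orbT.
have ep : e < dp by rewrite /e; lra.
have em : e < dm by rewrite /e; lra.
have ea : e < a by rewrite /e; lra.
have hend x s : U x -> a - e <= s <= a + e -> h x s < -1.
  move=> Oxx sa; have [[? ?] ?] := sU _ Oxx.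
  by apply: hAp => //; rewrite ltr_norml; lra.
have hend' x s : U x -> - a - e <= s <= - a + e -> h x s < -1.
  move=> Oxx sa; have [[? ?] ?] := sU _ Oxx.
  by apply: hAm => //; rewrite ltr_norml; lra.
have h0 x : U x -> -1 < h x 0 by move=> /sU [_ /hAz'].
have hact x t s : h (act t x) s = h x (s + t) + t by rewrite /h actD; ring.
(* Moving along the orbit shifts the window by [t]; the times gained or lost are within [e] of its
   ends, where [h] is below [h x 0], so the supremum does not see them. *)
have shift x t : U x -> `|t| <= e -> G (act t x) = G x + t.
  move=> Oxx; rewrite ler_norml => te; apply/eqP; rewrite eq_le; apply/andP; split.
    apply: Gle => s sa; rewrite hact lerD2r.
    have h0G : h x 0 <= G x by apply: Gub; lra.
    have h01 := h0 _ Oxx.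
    have [s1|s1] := lerP (s + t) a; last first.
      have : h x (s + t) < -1 by apply: hend => //; lra.
      by lra.
    have [s2|s2] := lerP (- a) (s + t); first by apply: Gub; lra.
    have : h x (s + t) < -1 by apply: hend' => //; lra.
    by lra.
  rewrite -lerBrDr; apply: Gle => s sa.
  have h0G : h x 0 + t <= G (act t x).
    by have := Gub (act t x) (- t); rewrite hact addNr; apply; lra.
  have h01 := h0 _ Oxx.
  have [s1|s1] := lerP (s - t) a; last first.
    have : h x s < -1 by apply: hend => //; lra.
    lra.
  have [s2|s2] := lerP (- a) (s - t).
    by have := Gub (act t x) (s - t); rewrite hact subrK; lra.
  have : h x s < -1 by apply: hend' => //; lra.
  lra.
exists (fun x => G x - G xb), U, e; split=> //.
  by move=> x; apply: cvgB; [exact: Gcont|exact: cvg_cst].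
split; first by rewrite subrr.
by move=> x t Oxx te; rewrite shift // addrAC.
Qed.

End LocalTime.

(** * Zero-dimensionality of the level set and construction of the section *)

Section CrossSection.
Hypothesis X_dim1 : covdim_le X 1.
Variables (tau : X -> R) (U : set X) (e : R).
Hypothesis tau_cont : continuous tau.
Hypothesis U_open : open U.
Hypothesis e0 : 0 < e.
Hypothesis tau_act : forall x t, U x -> `|t| <= e -> tau (act t x) = tau x + t.

Lemma strand_closed (K : set X) : closed K ->
  closed [set x | exists2 q : R * X, (- e <= q.1 <= e) /\ K q.2 & act q.1 q.2 = x].
Proof.
move=> cK; have -> : [set x | exists2 q : R * X, (- e <= q.1 <= e) /\ K q.2 & act q.1 q.2 = x]
   = (fun q : R * X => act q.1 q.2) @` (`[- e, e]%classic `*` K).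
  apply/seteqP; split=> x [q].
    by move=> [q1 q2] <-; exists q => //; split=> //=; rewrite in_itv.
  by move=> [/= + q2] <-; rewrite in_itv /= => q1; exists q.
apply: (compact_closed dist_hausdorff); apply: continuous_compact.
  exact: continuous_subspaceT.
apply: compact_setX; first exact: segment_compact.
exact: subclosed_compact cK X_compact _.
Qed.

Lemma translate_closed (K : set X) t : closed K -> closed [set x | exists2 y, K y & act t y = x].
Proof.
move=> cK; apply: (compact_closed dist_hausdorff); apply: continuous_compact.
  by apply: continuous_subspaceT => x N; exact: (act_near2 act_continuous).
exact: subclosed_compact cK X_compact _.
Qed.

(* A cover of order at most 2 refining the four sets "miss the strand of [y0] or
   miss the far strands, miss the bottom or miss the top" is coarsened to three
   open sets without a common point; [crossing_parity] applies to these. *)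
Lemma section_zero_dim y0 N : U y0 -> tau y0 = 0 -> nbhs y0 N ->
  exists D, [/\ closed D, D y0, D `<=` N, forall y, D y -> tau y = 0 &
    forall y, D y -> \forall z \near y, tau z = 0 -> D z].
Proof.
move=> Uy ty nN; have e_gt0 := e0; have me : - e <= e by lra.
have [eta [eta0 etaP]] : exists eta : R, 0 < eta /\ [set y | dist y0 y < eta] `<=` N `&` U.
  by apply: dist_nbhs; apply: filterI => //; apply: open_nbhs_nbhs.
have tau_cl : closed [set x | tau x = 0].
  have -> : [set x | tau x = 0] = tau @^-1` [set 0] by [].
  by move/continuous_closedP: tau_cont; apply; exact: closed_eq.
have dcl : continuous (dist^~ y0).
  move=> x; apply/cvgrPdist_lt => d d0; apply: filterS (dist_near x y0 d0) => x'.
  by rewrite distrC.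
(* The parity will be true at [y0] and false on the outer ring [K1]; the piece it cuts out stays
   within [eta / 4] of [y0], away from the rim of [K]. *)
pose K := [set y | dist y y0 <= eta / 2 /\ tau y = 0].
have cK : closed K.
  have h : closed ((dist^~ y0) @^-1` [set r | r <= eta / 2]).
    by move/continuous_closedP: dcl; apply; exact: closed_le.
  exact: closedI h tau_cl.
pose K1 := [set y | eta / 4 <= dist y y0 /\ K y].
have cK1 : closed K1.
  have h : closed ((dist^~ y0) @^-1` [set r | eta / 4 <= r]).
    by move/continuous_closedP: dcl; apply; exact: closed_ge.
  exact: closedI h cK.
have KU y : K y -> U y by move=> [yy _]; apply: (etaP y _).2; rewrite /= dist_sym; lra.
have Ky0 : K y0 by split=> //; rewrite dist_xx; lra.
have tK y (t : R) : K y -> - e <= t <= e -> tau (act t y) = t.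
  by move=> Ky te; rewrite tau_act ?ler_norml //; [have [_ ->] := Ky; rewrite add0r|exact: KU].
have c1 : closed [set y0] by apply: accessible_closed_set1; apply: hausdorff_accessible; exact: dist_hausdorff.
pose S0 := [set x | exists2 q : R * X, (- e <= q.1 <= e) /\ [set y0] q.2 & act q.1 q.2 = x].
pose S1 := [set x | exists2 q : R * X, (- e <= q.1 <= e) /\ K1 q.2 & act q.1 q.2 = x].
pose Bm := [set x | exists2 y, K y & act (- e) y = x].
pose Bp := [set x | exists2 y, K y & act e y = x].
have cS0 : closed S0 by exact: strand_closed.
have cS1 : closed S1 by exact: strand_closed.
have cBm : closed Bm by exact: translate_closed.
have cBp : closed Bp by exact: translate_closed.
have S01 x : S0 x -> S1 x -> False.
  move=> [[t y] /= [te ->] <-] [[s z] /= [se [zz Kz]] ez].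
  have ts : s = t by rewrite -(tK z s) // -(tK y0 t) // ez.
  have zy : z = y0 by rewrite -[z](actK act0 actD t) -{2}ts ez (actK act0 actD).
  by move: zz; rewrite zy dist_xx; lra.
have Bmp x : Bm x -> Bp x -> False.
  move=> [y Ky <-] [z Kz ez]; have h : tau (act e z) = e by apply: tK; rewrite // lexx andbT.
  have h2 : tau (act (- e) y) = - e by apply: tK; rewrite // lexx.
  by rewrite ez h2 in h; lra.
(* The four indices encode two binary choices: [i < 2] selects the strand to miss, the parity of [i]
   selects the end to miss. *)
pose V0 (i : 'I_4) := (if (i < 2)%N then ~` S0 else ~` S1) `&` (if odd i then ~` Bm else ~` Bp).
have V0o i : open (V0 i) by apply: openI; case: ifP => _; exact: closed_openC.
have V0c x : exists i, V0 i x.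
  have h (b c : bool) : exists i : 'I_4, (i < 2)%N = b /\ odd i = c.
    by case: b; case: c; [exists (inord 1)|exists (inord 0)|exists (inord 3)|exists (inord 2)];
      rewrite !inordK.
  have [i [i1 i2]] := h `[< ~ S0 x >] `[< ~ Bm x >].
  exists i; rewrite /V0 i1 i2; split; case: asboolP => // /contrapT h1 h2.
    exact: S01 h1 h2.
  exact: Bmp h1 h2.
have [n [V [Vo Vc Vr Vord]]] := X_dim1 V0o V0c.
have V0P j : (forall x, V j x -> ~ S0 x) \/ (forall x, V j x -> ~ S1 x).
  have [i ij] := Vr j; case E : (i < 2)%N; [left|right] => x /ij [];
  by rewrite E.
have V0B j : (forall x, V j x -> ~ Bm x) \/ (forall x, V j x -> ~ Bp x).
  have [i ij] := Vr j; case E : (odd i); [left|right] => x /ij [_];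
  by rewrite E.
(* Members that touch the top miss the bottom, and those that meet the strand of [y0] miss the far
   strands. Each member enters just one of [P], [A], [A'], so a triple point would lie in three
   distinct members. *)
pose hi j := exists x, V j x /\ Bp x.
pose nr j := exists x, V j x /\ S0 x.
pose A := \bigcup_(j in [set j | ~ hi j /\ nr j]) V j.
pose A' := \bigcup_(j in [set j | ~ hi j /\ ~ nr j]) V j.
pose P := \bigcup_(j in [set j | hi j]) V j.
have [||||||||kap [lk kap1 kap0]] := @crossing_parity R X act X_compact act_continuous act0 actD
  K A A' P e e0.
- by apply: bigcup_open => j _.
- by apply: bigcup_open => j _.
- by apply: bigcup_open => j _.
- move=> x; have [j Vj] := Vc x; have [hj|hj] := pselect (hi j).
    by apply: Or33; exists j.
  have [nj|nj] := pselect (nr j); first by apply: Or31; exists j.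
  by apply: Or32; exists j.
- move=> x [i [hi1 nr1] Vi] [j [hj nrj] Vj] [k hk Vk].
  have ij : i != j by apply/eqP => ij; apply: nrj; rewrite -ij.
  have ik : i != k by apply/eqP => ik; apply: hi1; rewrite ik.
  have jk : j != k by apply/eqP => jk; apply: hj; rewrite jk.
  have := Vord x [:: i; j; k]; rewrite /= !inE negb_or ij ik jk.
  move=> /(_ isT) h; suff : (3 <= 2)%N by []; apply: h => q.
  by rewrite !inE => /or3P[] /eqP ->.
- move=> z Kz [j [w [Vw Bw]] Vj].
  have [h|h] := V0B j; first by apply: (h _ Vj); exists z.
  exact: h Vw Bw.
- by move=> z Kz [j [hj _] Vj]; apply: hj; exists (act e z); split=> //; exists z.
- by move=> z Kz [j [hj _] Vj]; apply: hj; exists (act e z); split=> //; exists z.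
have far z : K1 z -> ~~ kap z.
  move=> K1z; apply: kap0; first by case: K1z.
  move=> t te [j [_ [w [Vw S0w]]] Vj].
  have [h|h] := V0P j; first exact: h Vw S0w.
  by apply: (h _ Vj); exists (t, z) => //=; rewrite -ler_norml.
have kapy0 : kap y0.
  apply: kap1 => // t te [j [_ nj] Vj]; apply: nj; exists (act t y0); split=> //.
  by exists (t, y0) => //=; rewrite -ler_norml.
have Dsm z : K z -> kap z -> dist z y0 < eta / 4.
  move=> Kz kz; rewrite ltNge; apply/negP => h.
  by have := far z (conj h Kz); rewrite kz.
have Dnear z b : K z -> dist z y0 < eta / 2 -> kap z = b ->
    \forall w \near z, tau w = 0 -> K w /\ kap w = b.
  move=> Kz zz kz; have eh : 0 < eta / 2 - dist z y0 by rewrite subr_gt0.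
  apply: filterS2 (lk _ Kz) (dist_near z y0 eh) => w h1 h2 tw.
  have Kw : K w by split=> //; move: h2; rewrite ltr_norml; lra.
  by split=> //; rewrite h1.
exists [set z | K z /\ kap z]; split.
- move=> z clz; have Kz : K z by apply: cK; apply: closureS clz => w [].
  by split=> //; have [w [[Kw kw] h]] := clz _ (lk _ Kz); rewrite -(h Kw).
- by [].
- by move=> y [Ky ky]; apply: (etaP y _).1; rewrite /= dist_sym; have := Dsm _ Ky ky; lra.
- by move=> y [[]].
- move=> y [Ky ky]; apply: (Dnear y true Ky _ ky).
  by have := Dsm _ Ky ky; lra.
Qed.


(** Near the clopen piece [C] of [tau = 0] time runs at unit speed, which excludes returns up to
    time [e] and lets nearby points be flowed onto [C]. *)
Lemma transversal_exists xb : U xb -> tau xb = 0 ->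
  (forall x N, nbhs xb N -> exists t : R, 0 < t /\ N (act t x)) ->
  exists C r, transversal act xb C r e.
Proof.
move=> Uxb txb dense; have e_gt0 := e0.
have [C [cC Cxb CU Ct Cn]] : exists C, [/\ closed C, C xb, C `<=` U,
    forall y, C y -> tau y = 0 & forall y, C y -> \forall z \near y, tau z = 0 -> C z].
  by apply: section_zero_dim => //; apply: open_nbhs_nbhs.
have no_hit y (t : R) : C y -> 0 < t <= e -> ~ C (act t y).
  move=> Cy te /Ct; rewrite tau_act ?(Ct _ Cy) ?add0r; last 2 first.
  - exact: CU.
  - by rewrite gtr0_norm; lra.
  by move=> t0; rewrite t0 in te; lra.
(* Flowing by [- tau x] reaches [tau = 0] near [y], and [C] is relatively open in that level set. *)
have slide y (dl : R) N : C y -> 0 < dl -> nbhs y N ->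
    \forall x \near y, [/\ `|tau x| < dl, C (act (- tau x) x) & N (act (- tau x) x)].
  move=> Cy dl0 nN.
  have ny : nbhs (act 0 y) ([set z | tau z = 0 -> C z] `&` N).
    by rewrite act0; apply: filterI => //; exact: Cn.
  have [d [d0 [A nA hA]]] := act_near act_continuous ny.
  pose q : R := Num.min dl (Num.min d e).
  have q0 : 0 < q by rewrite !lt_min dl0 d0.
  have tq : \forall x \near y, `|tau x| < q.
    have /cvgrPdist_lt /(_ _ q0) := @tau_cont y; apply: filterS => x.
    by rewrite (Ct _ Cy) sub0r normrN.
  have nU : nbhs y U by apply: open_nbhs_nbhs; split=> //; exact: CU.
  apply: filterS3 tq nA nU => x; rewrite !lt_min => /and3P[t1 t2 t3] Ax Ux.
  have [|h Nx] := hA (- tau x) x _ Ax; first by rewrite sub0r opprK.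
  by split=> //; apply: h; rewrite tau_act ?subrr // normrN ltW.
(* Density is applied from [act e x], so that the correction, smaller than [e], keeps the total time
   positive. *)
have hit x N : nbhs xb N -> exists t, [/\ 0 < t, C (act t x) & N (act t x)].
  move=> nN; have [t [t0 [tt Ct' Nt]]] := dense (act e x) _ (slide _ _ _ Cxb e0 nN).
  exists (- tau (act t (act e x)) + (t + e)).
  by rewrite !actD; split=> //; move: tt; rewrite ltr_norml; lra.
have opC x t : ~ C (act t x) -> exists d : R, 0 < d /\ exists2 A, nbhs x A &
    forall t' x', `|t - t'| < d -> A x' -> ~ C (act t' x').
  move=> nC; apply: (act_near (N := ~` C) act_continuous).
  by apply: open_nbhs_nbhs; split=> //; exact: closed_openC.
have first y : C y -> exists r : R, [/\ e <= r, C (act r y) &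
    forall t, 0 < t < r -> ~ C (act t y)].
  (* Returns up to time [e] are excluded, so the infimum of the later ones is the first return; it
     is attained because [C] is closed. *)
  move=> Cy; pose S := [set t | e <= t /\ C (act t y)].
  have Sinf : has_inf S.
    split; last by exists e => t [].
    have [t [t0 Ctt _]] := hit y setT filterT; exists t; split=> //.
    by rewrite leNgt; apply/negP => te; apply: (no_hit y t) => //; rewrite t0 ltW.
  have re : e <= inf S by apply: lb_le_inf; [case: Sinf|move=> t []].
  exists (inf S); split=> //.
    apply: contrapT => nC; have [d [d0 [A nA hA]]] := opC _ _ nC.
    have [t [te Ctt] tlt] := inf_adherent d0 Sinf.
    have ti : inf S <= t by apply: inf_lbound; [case: Sinf|].
    apply: (hA t y _ (nbhs_singleton nA)) => //.
    by rewrite ltr_norml; lra.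
  move=> t /andP[t0 tr] Ctt; have [te|te] := leP t e.
    by apply: (no_hit y t) => //; rewrite t0.
  have : inf S <= t by apply: inf_lbound; [case: Sinf|split=> //; exact: ltW].
  by rewrite leNgt tr.
have ex y : exists r : R, C y -> [/\ e <= r, C (act r y) &
    forall t, 0 < t < r -> ~ C (act t y)].
  have [Cy|nC] := pselect (C y); last by exists 0.
  by have [r rP] := first _ Cy; exists r.
have [r rP] := choice ex; exists C, r.
have r_first y (t : R) : C y -> 0 < t -> C (act t y) -> r y <= t.
  move=> Cy t0 Ctt; rewrite leNgt; apply/negP => tr.
  by have [_ _ h] := rP _ Cy; apply: (h t) => //; rewrite t0.
split=> //.
- by move=> y /rP [].
- by move=> y /rP [].
- by move=> y t /rP [_ _]; apply.
(* Hitting times are bounded by some [M]: starting [M] units in the past, the orbit meets [C] by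
   time 0, and one then advances return by return. *)
- have bounded : exists M : nat, forall x, exists t : R, [/\ 0 < t, t <= M%:R & C (act t x)].
    have : \forall M \near \oo, forall x, [set: X] x ->
        exists t : R, [/\ 0 < t, t <= M%:R & C (act t x)].
      apply: compact_near => // x _; have [t [t0 Ctt _]] := hit x setT filterT.
      have near_t : nbhs (act t x) [set z | `|tau z| < t /\ C (act (- tau z) z)].
        by apply: filterS (slide (act t x) t setT Ctt t0 (@filterT _ _ _)) => z [].
      exists [set x' | `|tau (act t x')| < t /\ C (act (- tau (act t x')) (act t x'))],
        [set M | (Num.truncn (2 * t) < M)%N]; split.
      - exact: (act_near2 act_continuous near_t).
      - by exists (Num.truncn (2 * t)).+1.
      - move=> x' M _ [tx Cx] /= tM; exists (- tau (act t x') + t); rewrite actD.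
        have t2 : 0 <= 2 * t by lra.
        have /andP[_ h2] := truncn_itv t2.
        have h3 : (Num.truncn (2 * t)).+1%:R <= M%:R :> R by rewrite ler_nat.
        by split=> //; move: tx; rewrite ltr_norml; lra.
    by move=> [M _ hM]; exists M => x; apply: (hM M) => /=.
  have desc : forall n y (t : R), C y -> 0 <= t -> t < n%:R * e ->
      exists z s, [/\ C z, 0 <= s < r z & act t y = act s z].
    elim=> [|n IH] y t Cy t0 tn; first by lra.
    have [er Cr _] := rP _ Cy; have [lt|ge] := ltP t (r y).
      by exists y, t; rewrite t0.
    have [|||z [s [Cz sz e1]]] := IH (act (r y) y) (t - r y) => //.
    - by rewrite subr_ge0.
    - by move: tn; rewrite -natr1 mulrDl; lra.
    by exists z, s; split=> //; rewrite -e1 -actD subrK.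
  move=> x; have [M hM] := bounded; have [t [t0 tM Ctt]] := hM (act (- M%:R) x).
  have m0 : 0 <= M%:R - t by lra.
  have me : 0 <= (M%:R - t) / e by apply: divr_ge0; lra.
  have /andP[_ h2] := truncn_itv me.
  have [|z [s [Cz sz e1]]] := desc (Num.truncn ((M%:R - t) / e)).+1 _ _ Ctt m0.
    by rewrite -ltr_pdivrMr.
  by exists z, s; split=> //; rewrite -e1 -!actD subrK subrr act0.
- move=> y e1 Cy e10 /=; have [er Cr hr] := rP _ Cy.
  pose q : R := Num.min e1 (e / 2).
  have q0 : 0 < q by rewrite lt_min e10 divr_gt0.
  have q1 : q <= e1 by rewrite ge_min lexx.
  have q2 : q <= e / 2 by rewrite ge_min lexx orbT.
  have near0 : nbhs (act (r y) y) [set z | `|tau z| < q /\ C (act (- tau z) z)].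
    by apply: filterS (slide _ q setT Cr q0 (@filterT _ _ _)) => z [].
  have near1 := act_near2 act_continuous near0.
  (* No return of [y] on this compact interval of times persists nearby and bounds [r z] below;
     flowing onto [C] around time [r y] bounds it above. *)
  have near2 : \forall z \near y, forall t : R, `[e, r y - q]%classic t -> ~ C (act t z).
    apply: compact_near; first exact: segment_compact.
    move=> t; rewrite /= in_itv /= => te.
    have [|d [d0 [A nA hA]]] := opC y t; first by apply: hr; lra.
    exists [set t' | `|t - t'| < d], A; split=> //; first by apply/nbhs_ballP; exists d.
    by move=> t' x' _; exact: hA.
  apply: filterS2 near1 near2 => z [tz Cz'] h2 Cz.
  have [erz Crz hrz] := rP _ Cz.
  have up : r z <= - tau (act (r y) z) + r y.
    by apply: r_first => //; [move: tz; rewrite ltr_norml; lra|rewrite actD].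
  have lo : r y - q < r z.
    rewrite ltNge; apply/negP => le; apply: (h2 (r z)) => //.
    by rewrite /= in_itv /= erz le.
  by move: tz; rewrite !ltr_norml; lra.
- move=> y N Cy nN.
  have [D [cD Dy DN Dt Dn]] := section_zero_dim (CU _ Cy) (Ct _ Cy) nN.
  exists (D `&` C); split.
  + by [].
  + by move=> z [/DN].
  + exact: closedI.
  + have -> : C `\` (D `&` C) = C `&` ~` [set z | tau z = 0 -> D z]°.
      apply/seteqP; split=> z [Cz h]; split=> //.
        by move=> /interior_subset /= /(_ (Ct _ Cz)) Dz; apply: h.
      by move=> [Dz _]; apply: h; exact: Dn.
    by apply: closedI => //; apply: open_closedC; exact: open_interior.
Qed.

End CrossSection.
End MetricFlow.

(** * Minimal flows, periodic base points and the conclusion *)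

Lemma minimal_dense_at (R : realType) (X : topologicalType) (act : R -> X -> X) :
  compact [set: X] -> continuous (fun q : R * X => act q.1 q.2) ->
  (forall s t x, act (s + t) x = act s (act t x)) ->
  minimal_flow act -> forall xb, dense_at act xb.
Proof.
move=> cX ca actD mini xb y U nU.
have [M hM] : exists M : nat, forall x, exists t : R, `|t| <= M%:R /\ U (act t x).
  have : \forall M \near \oo, forall x, [set: X] x -> exists t : R, `|t| <= M%:R /\ U (act t x).
    apply: compact_near => // x _.
    have : closure (range (fun t => act t x)) xb by rewrite mini.
    move=> /(_ _ (nbhs_interior nU)) [_ [[t _ <-] nUt]].
    exists [set x' | U (act t x')], [set M | (Num.truncn `|t| < M)%N]; split.
    - exact: (act_near2 ca nUt).
    - by exists (Num.truncn `|t|).+1.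
    - move=> x' M _ /= Ux' tM; exists t; split=> //.
      have /andP[_ h2] := truncn_itv (normr_ge0 t).
      by apply: le_trans (ltW h2) _; rewrite ler_nat.
  by move=> [M _ hM]; exists M => x; apply: (hM M) => /=.
(* Starting at time [M + 1] turns a hitting time of either sign, at most [M] in absolute value, into
   a positive one. *)
have [t [tM Ut]] := hM (act (M%:R + 1) y).
exists (t + (M%:R + 1)); rewrite actD; split=> //.
by move: tM; rewrite ler_norml; lra.
Qed.

(** A periodic orbit is compact, hence closed; if [xb] were off it, its complement would be a
    neighbourhood of [xb] that this orbit never enters. *)
Lemma periodic_base (R : realType) (X : topologicalType) (act : R -> X -> X) xb :
  hausdorff_space X -> continuous (fun q : R * X => act q.1 q.2) ->
  (forall x, act 0 x = x) ->
  (forall s t x, act (s + t) x = act s (act t x)) ->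
  dense_at act xb -> ~ aperiodic act -> exists t : R, 0 < t /\ act t xb = xb.
Proof.
move=> hX ca act0 actD dxb nap.
have [x [t [t0 tx]]] : exists x (t : R), 0 < t /\ act t x = x.
  apply: contrapT => h; apply: nap => x t tn0 tx; apply: h.
  have [t0|t0] := ltP 0 t; first by exists x, t.
  exists x, (- t); split; first by rewrite oppr_gt0 lt_neqAle tn0.
  by rewrite -{1}tx -actD addNr act0.
have txn n : act (n%:R * t) x = x.
  by elim: n => [|n IH]; rewrite ?mul0r ?act0 // -natr1 mulrDl mul1r actD tx.
have cK : closed ((fun s => act s x) @` `[0, t]%classic).
  apply: compact_closed => //; apply: continuous_compact; last exact: segment_compact.
  apply: continuous_subspaceT; exact: orbit_continuous.
have [s _ sx] : ((fun s => act s x) @` `[0, t]%classic) xb.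
  apply: contrapT => nK.
  have [s [s0 ns]] := dxb x _ (open_nbhs_nbhs (conj (closed_openC cK) nK)).
  apply: ns; have st0 : 0 <= s / t by rewrite divr_ge0 // ltW.
  have /andP[h1 h2] := truncn_itv st0; set n := Num.truncn _ in h1 h2.
  exists (s - n%:R * t).
    rewrite ler_pdivlMr // in h1; rewrite ltr_pdivrMr // -natr1 mulrDl in h2.
    by rewrite /= in_itv /=; lra.
  by rewrite -{1}(txn n) -actD subrK.
by exists t; split=> //; rewrite -sx -actD addrC actD tx.
Qed.

Lemma expansions_at (R : realType) (X : topologicalType) (act : R -> X -> X) (xb : X) :
  flow_space act -> dense_at act xb ->
  (aperiodic act ->
     exists (k : nat -> nat) (f : nat -> R * R -> R * R) (p : nat -> X -> R * R),
       expansion act xb k f p /\ forall i, proper_map (k i.+1) (f i)) /\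
  (~ aperiodic act ->
     exists (k : nat -> nat) (f : nat -> R * R -> R * R) (p : nat -> X -> R * R),
       expansion act xb k f p /\
       forall n, (0 < n)%N -> degenerate_proper (k n) (fcomp f 0 n)).
Proof.
move=> [cX [dist [dge deq dsym dtri dopen]] [dim1 _] ca [act0 actD nofix]] dxb.
have hX := dist_hausdorff dge deq dsym dtri dopen.
have [tau [U [e [ctau oU Uxb e0 [txb tact]]]]] :=
  local_time ca act0 actD dge deq dsym dtri dopen (nofix xb).
have [C [r tr]] := transversal_exists cX ca act0 actD dge deq dsym dtri dopen dim1
  ctau oU e0 tact Uxb txb dxb.
have [|g [lg gsep]] := separating_labels cX tr (fun x y => (deq x y).1) dge dsym dtri.
  by move=> x d d0; exact: (dist_ball deq dtri dopen).
pose T y := act (r y) y.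
have Ccpt := sec_compact cX tr.
have levels := levels_exist (T := T) Ccpt hX (tr_base tr) (tr_ret tr)
  (sec_T_inj act0 actD tr) (sec_T_surj act0 actD tr) (sec_T_cont ca tr)
  (sec_T_hits actD tr) (sec_zd tr) lg.
split=> [ap|nap].
  (* The whole section serves as base of level 0; properness comes from the refinement steps
     alone. *)
  have [||l [_ lok lref]] := levels xpredT; [exact: loc_const_cst|by []|].
  exists (fun n => lv_k (l n)); do 2 eexists; split.
    exact: (level_expansion cX hX ca act0 actD tr gsep lok lref).
  exact: (level_proper cX hX ca act0 actD tr lok lref ap).
have [t [t0 tx]] := periodic_base hX ca act0 actD dxb nap.
have [N per] : exists N, iter N.+1 T xb = xb.
  have te0 : 0 <= t / e by rewrite divr_ge0 ?ltW.
  have [||m em] := @sec_hit_iter _ _ _ actD _ _ _ _ tr (Num.truncn (t / e)).+1 xb t (tr_base tr) t0.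
  - rewrite -ltr_pdivrMr //; by have /andP[] := truncn_itv te0.
  - by rewrite tx; exact: (tr_base tr).
  by exists m; rewrite -em.
(* The base of level 0 isolates [xb] in its finite orbit under [T], as [level_degenerate_proper]
   demands. *)
have [d [ld dx dP]] := periodic_clopen hX (tr_base tr) (tr_ret tr) (sec_zd tr) per.
have [l [l0 lok lref]] := levels d ld dx.
exists (fun n => lv_k (l n)); do 2 eexists; split.
  exact: (level_expansion cX hX ca act0 actD tr gsep lok lref).
apply: (level_degenerate_proper cX hX ca act0 actD tr lok lref).
by rewrite l0.
Qed.

Theorem theorem3p5 (R : realType) (X : topologicalType) (act : R -> X -> X) :
  flow_space act ->
  (forall xb : X, dense_at act xb ->
     (aperiodic act ->
        exists (k : nat -> nat) (f : nat -> R * R -> R * R) (p : nat -> X -> R * R),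
          expansion act xb k f p /\ forall i, proper_map (k i.+1) (f i)) /\
     (~ aperiodic act ->
        exists (k : nat -> nat) (f : nat -> R * R -> R * R) (p : nat -> X -> R * R),
          expansion act xb k f p /\
          forall n, (0 < n)%N -> degenerate_proper (k n) (fcomp f 0 n))) /\
  (minimal_flow act ->
     forall xb : X, exists (k : nat -> nat) (f : nat -> R * R -> R * R) (p : nat -> X -> R * R),
       expansion act xb k f p).
Proof.
move=> fs; split=> [xb|mini xb]; first exact: expansions_at.
have dxb : dense_at act xb.
  by have [cX _ _ ca [_ actD _]] := fs; exact: minimal_dense_at.
have [ap nap] := expansions_at fs dxb; have [h|h] := pselect (aperiodic act).
  by have [k [f [p [ex _]]]] := ap h; exists k, f, p.
by have [k [f [p [ex _]]]] := nap h; exists k, f, p.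
Qed.
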